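(* Let $\mathbf{T}\equiv(T_1,T_2)$ be a commuting pair of bounded linear operators on a complex Hilbert space $\mathcal{H}$. For $k\ge 1$ let $\mathbf{T}(k):=(T_1,T_2,T_1^2,T_2T_1,T_2^2,\dots,T_1^k,T_2T_1^{k-1},\dots,T_2^k)$ be the tuple of all monomials $T_2^{j}T_1^{i}$ with $i,j\ge 0$ and $1\le i+j\le k$. The following statements are equivalent. (i) $\mathbf{T}$ is subnormal. (ii) $\mathbf{T}(k)$ is subnormal for all integers $k\ge 1$. (iii) $\mathbf{T}$ is $k$-hyponormal for all integers $k\ge 1$.
   Context: For $S,T\in\mathcal{B}(\mathcal{H})$ (bounded operators on $\mathcal{H}$) put $[S,T]:=ST-TS$. An $n$-tuple $\mathbf{S}=(S_1,\dots,S_n)$ of operators on $\mathcal{H}$ is (jointly) hyponormal if the $n\times n$ operator matrix whose $(i,j)$ entry (row $i$, column $j$) is $[S_j^*,S_i]$ is a positive (i.e. positive semidefinite) operator on the direct sum of $n$ copies of $\mathcal{H}$. An $n$-tuple is normal if its entries commute and each entry is a normal operator; an $n$-tuple on $\mathcal{H}$ is subnormal if it is the restriction to $\mathcal{H}$ of a normal $n$-tuple acting on some Hilbert space $\mathcal{K}\supseteq\mathcal{H}$ which leaves $\mathcal{H}$ invariant. For $k\ge 1$, a commuting pair $\mathbf{T}=(T_1,T_2)$ is $k$-hyponormal if the tuple $\mathbf{T}(k)$ is hyponormal; equivalently, the operator matrix with rows indexed by $(m,n)$, columns indexed by $(p,q)$ ($m,n,p,q\ge 0$ integers, $1\le m+n\le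 k$, $1\le p+q\le k$) and entries $[(T_2^qT_1^p)^*,T_2^nT_1^m]$ is positive. *)

(* Defs.v *)
From HB Require Import structures.
From mathcomp Require Import all_boot all_order all_algebra.
From mathcomp Require Import all_classical all_reals all_analysis.
From mathcomp Require Import complex ring lra.

Set Implicit Arguments.
Unset Strict Implicit.
Unset Printing Implicit Defensive.

Import Order.TTheory GRing.Theory Num.Theory.
Import numFieldNormedType.Exports.

Local Open Scope classical_set_scope.
Local Open Scope ring_scope.

(* The inner product [dot x y] is linear in [x] and conjugate-linear in [y]. *)
HB.mixin Record NormedModule_isHilbert (R : realType) V
    of CompleteNormedModule R[i] V := {
  dot : {dot V for @Num.conj R[i]} ;
  normr_dot : forall x : V, `|x| ^+ 2 = dot x x
}.

#[short(type="hilbertType")]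
HB.structure Definition Hilbert (R : realType) :=
  {V of CompleteNormedModule R[i] V & NormedModule_isHilbert R V}.

Local Notation "''[' x , y ]" := (dot x y) : ring_scope.

Section Operators.
Context {R : realType}.
Implicit Types H K : hilbertType R.

Definition bounded_op H (T : H -> H) : Prop :=
  linear T /\ exists M : R[i], forall x, `|T x| <= M * `|x|.

Definition commute_op H (S T : H -> H) : Prop := S \o T =1 T \o S.

(* [adjoint T y] is the unique [z] such that ['[T x, y] = '[x, z]] for all
   [x]; for a bounded [T] it exists by lemma [adjointP] below. *)
Definition adjoint H (T : H -> H) : H -> H :=
  fun y => get [set z | forall x, '[T x, y] = '[x, z]].

(* The squared norm as an element of [R]. *)
Let nr2 H (x : H) : R := complex.Re '[x, x].

Let nr2E H (x : H) : '[x, x] = (nr2 x)%:C%C.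
Proof. by rewrite /nr2 RRe_real// ger0_real// -normr_dot exprn_ge0. Qed.

Let nr2_ge0 H (x : H) : 0 <= nr2 x.
Proof. by rewrite -ler0c -nr2E -normr_dot exprn_ge0. Qed.

Let nr2D H (x y : H) : nr2 (x + y) = nr2 x + nr2 y + 2 * complex.Re '[x, y].
Proof.
rewrite /nr2 linearDl !linearDr /= (hermC _ y x) /= expr0 mul1r.
by case: ('[x, x]) ('[y, y]) ('[x, y]) => [a b] [c d] [e f] /=; lra.
Qed.

Let nr2Z H (a : R[i]) (x : H) : nr2 (a *: x) = complex.Re (a * a^*) * nr2 x.
Proof.
rewrite {1}/nr2 linearZl_LR linearZr_LR /= nr2E mulrA.
by case: (a * _) => u v /=; lra.
Qed.

Let dot_sep H (z w : H) : (forall x, '[x, z] = '[x, w]) -> z = w.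
Proof.
move=> zw; apply/eqP; rewrite -subr_eq0 -normr_eq0 -sqrf_eq0 normr_dot.
by rewrite linearBr /= zw subrr.
Qed.

Let nr2_lt H (x : H) (e : R) : 0 < e -> (nr2 x < e ^+ 2) = (`|x| < e%:C%C).
Proof.
move=> e0; rewrite -[RHS](@ltr_pXn2r _ 2)// ?nnegrE ?ler0c ?(ltW e0)//.
by rewrite normr_dot nr2E -rmorphXn ltcR.
Qed.

Let riesz H (f : H -> R[i]) (c : R) :
    (forall a u v, f (a *: u + v) = a * f u + f v) ->
    (forall z, 2 * complex.Re (f z) <= nr2 z + c) ->
  exists z0, forall x, f x = '[x, z0].
Proof.
move=> flin fc; pose J z := nr2 z - 2 * complex.Re (f z).
have f0 : f 0 = 0.
  by have := flin (-1) 0 0; rewrite scaler0 addr0 mulN1r addNr.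
have fZ a u : f (a *: u) = a * f u.
  by have := flin a u 0; rewrite f0 !addr0.
have fD u v : f (u + v) = f u + f v.
  by have := flin 1 u v; rewrite scale1r mul1r.
have hasinf : has_inf (range J).
  split; first by exists (J 0), 0.
  by exists (- c) => _ [z _ <-]; have := fc z; rewrite /J; lra.
pose m := inf (range J).
have Jm z : m <= J z by apply: ge_inf; [case: hasinf|exists z].
have Jadh n : exists z, J z < m + n.+1%:R^-1.
  have n0 : 0 < n.+1%:R^-1 :> R by rewrite invr_gt0.
  by have [_ [z _ <-] ?] := inf_adherent n0 hasinf; exists z.
have {Jadh} [u Ju] := choice Jadh.
have halfE : 2^-1 = (2^-1 : R)%:C%C :> R[i] by rewrite fmorphV rmorph_nat.
have par x y : nr2 (x - y) = 2 * J x + 2 * J y - 4 * J (2^-1 *: (x + y)).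
  have e1 := nr2D x y; have := nr2D x (- y).
  rewrite linearNr /= -(scaleN1r y) nr2Z.
  have -> : complex.Re (-1 * (-1)^*) = 1 :> R by rewrite rmorphN1 mulrNN mulr1.
  rewrite /J nr2Z fZ fD e1 => ->.
  rewrite halfE conj_Creal ?ger0_real ?ler0c ?invr_ge0// -rmorphM /=.
  by case: ('[x, y]) (f x) (f y) => [a b] [c1 d] [e g] /=; field.
have cau n p : nr2 (u n - u p) < 2 * n.+1%:R^-1 + 2 * p.+1%:R^-1.
  rewrite par; have := Jm (2^-1 *: (u n + u p)).
  move: (J _) (Ju n) (Ju p) => j.
  by move: (J (u n)) (J (u p)) (n.+1%:R^-1) (p.+1%:R^-1) => /= *; lra.
have small (e : R) : 0 < e -> \forall n \near \oo, n.+1%:R^-1 < e.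
  by move=> e0; exact: (near_infty_natSinv_lt (PosNum e0)).
have /cauchy_cvgP/cvg_ex[z0 uz0] : cauchy (u @ \oo).
  apply: cauchy_exP => e e0.
  have re0 : 0 < complex.Re e by move: e0; rewrite ltcE => /andP[].
  have eE : e = (complex.Re e)%:C%C by rewrite RRe_real// gtr0_real.
  have s4 : 0 < (complex.Re e) ^+ 2 / 4 by rewrite divr_gt0// exprn_gt0.
  have [N _ HN] := small _ s4.
  exists (u N); exists N => // n /= /HN hn.
  rewrite -ball_normE /ball_/= eE -nr2_lt//.
  apply: (lt_le_trans (cau _ _)).
  have hN : N.+1%:R^-1 < complex.Re e ^+ 2 / 4 by apply: HN => /=.
  by move: hn hN; move: (n.+1%:R^-1) (N.+1%:R^-1) (complex.Re e ^+ 2) => /= *; lra.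
exists z0 => x.
have main t : 0 <= nr2 (t *: x) + complex.Re (t * ('[x, z0] - f x)).
  apply/ler_addgt0Pr => e e0.
  have es : 0 < Num.min 1 e by rewrite lt_min ltr01.
  have nz : \forall n \near \oo, nr2 (z0 - u n) < e.
    have e1 : 0 < (Num.min 1 e)%:C%C by rewrite ltcR.
    move/cvgrPdist_lt : uz0 => /(_ _ e1); apply: filterS => n.
    rewrite -nr2_lt// => /lt_le_trans; apply.
    by case: (leP 1 e) => ?; nra.
  have [n [nz1 nz2]] := filter_ex (filterI nz (small _ e0)).
  have h1 := Jm (u n + t *: x); have h2 := Ju n.
  have h3 : 0 <= nr2 (t *: x) + nr2 (z0 - u n) +
                 2 * complex.Re '[t *: x, z0 - u n] by rewrite -nr2D nr2_ge0.
  move: h1 h2; rewrite /J nr2D fD fZ => h1 h2.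
  have h4 : complex.Re '[u n, t *: x] = complex.Re '[t *: x, u n].
    by rewrite hermC /= expr0 mul1r; case: ('[t *: x, u n]).
  have h5 : complex.Re (t * ('[x, z0] - f x)) =
    complex.Re '[t *: x, z0 - u n] + complex.Re '[t *: x, u n]
      - complex.Re (t * f x).
    rewrite mulrBr (linearBr dot) !linearZl_LR /=.
    by case: (t * _) (t * _) (t * _) => [? ?] [? ?] [? ?] /=; lra.
  move: h1 h2 h3 nz1 nz2; rewrite h5 h4 /= raddfD /=.
  by move: (n.+1%:R^-1) => i *; lra.
apply: esym; apply: subr0_eq; apply: normr0_eq0.
set d := _ - f x in main *.
pose D := complex.Re (d * d^*); pose X := nr2 x.
have X0 : 0 <= X by exact: nr2_ge0.
have DE : `|d| ^+ 2 = D%:C%C.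
  by rewrite /D -normCK RRe_real// ger0_real// exprn_ge0.
have D0 : 0 <= D by rewrite -ler0c -DE exprn_ge0.
apply/eqP; rewrite -sqrf_eq0 DE; suff -> : D = 0 by rewrite eqxx.
have X1 : 1 + X != 0 by rewrite gt_eqF// ltr_pwDl.
pose s := (1 + X)^-1; have sX : s * X = 1 - s by rewrite /s; field.
have s0 : 0 < s by rewrite invr_gt0 ltr_pwDl.
have := main ((- s)%:C%C * d^*); rewrite nr2Z.
have sC : ((- s)%:C%C)^* = (- s)%:C%C :> R[i].
  by rewrite conj_Creal// complex_real.
have -> : complex.Re ((- s)%:C%C * d^* * ((- s)%:C%C * d^*)^*) = s ^+ 2 * D.
  have conjM (a b : R[i]) : (a * b)^* = a^* * b^* by exact: rmorphM.
  rewrite conjM sC conjCK mulrACA -rmorphM /= [d^* * d]mulrC /D.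
  by case: (d * _) => ? ? /=; ring.
have -> : complex.Re ((- s)%:C%C * d^* * d) = - s * D.
  by rewrite -mulrA [d^* * d]mulrC /D; case: (d * _) => ? ? /=; ring.
rewrite -/X (_ : s ^+ 2 * D * X = s * (s * X) * D); last by ring.
rewrite sX => h; apply: le_anti; rewrite D0 andbT.
rewrite -(pmulr_rle0 _ (exprn_gt0 2 s0)) -oppr_ge0.
by rewrite (_ : - _ = s * (1 - s) * D + - s * D)//; ring.
Qed.

Lemma adjointP H (T : H -> H) :
  bounded_op T -> forall x y, '[T x, y] = '[x, adjoint T y].
Proof.
move=> [Tlin [M TM]] x y; move: x.
suff : [set z | forall x, '[T x, y] = '[x, z]] !=set0 by move=> /getPex.
pose B := complex.Re (`|M| ^+ 2).
have BE : `|M| ^+ 2 = B%:C%C by rewrite /B RRe_real// ger0_real// exprn_ge0.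
have B0 : 0 <= B by rewrite -ler0c -BE exprn_ge0.
have TB z : nr2 (T z) <= B * nr2 z.
  rewrite -lecR rmorphM /= -BE -!nr2E -!normr_dot -exprMn.
  rewrite lerXn2r ?nnegrE ?mulr_ge0//.
  have := TM z => h; have h0 := le_trans (normr_ge0 _) h.
  by rewrite -(ger0_norm h0) normrM normr_id in h.
pose s := Num.sqrt (1 + B).
have s0 : 0 < s by rewrite sqrtr_gt0; lra.
have s2 : s ^+ 2 = 1 + B by rewrite sqr_sqrtr; lra.
apply: (@riesz _ _ ((1 + B) * nr2 y)) => [a u v|z].
  by rewrite Tlin linearDl linearZl_LR.
have cR (r : R) : (r%:C%C)^* = r%:C%C :> R[i].
  by rewrite conj_Creal// complex_real.
have := nr2_ge0 (s^-1%:C%C *: T z + (- s)%:C%C *: y).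
have reM (a b : R) (w : R[i]) :
  complex.Re (a%:C%C * (b%:C%C * w)) = a * b * complex.Re w.
  by case: w => ? ? /=; ring.
rewrite nr2D !nr2Z linearZl_LR (linearZr_LR dot) /= !cR reM /=.
rewrite (mulrN s^-1) mulVf ?gt_eqF// mulN1r oppr0 mulr0 !subr0.
rewrite mulrNN -invfM -!expr2 s2.
have B1 : 0 < 1 + B by rewrite ltr_pwDl.
have : (1 + B)^-1 * nr2 (T z) <= nr2 z.
  rewrite ler_pdivrMl//; apply: le_trans (TB z) _.
  by rewrite ler_wpM2r ?nr2_ge0// lerDr.
by move: ((1 + B)^-1 * _) ((1 + B) * _) => *; lra.
Qed.

Lemma adjoint_unique H (T B : H -> H) :
  (forall x y, '[T x, y] = '[x, B y]) -> adjoint T =1 B.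
Proof.
move=> TB y; apply: dot_sep => x; rewrite -TB.
have : [set z | forall x, '[T x, y] = '[x, z]] !=set0.
  by exists (B y) => ?; exact: TB.
by move=> /getPex /(_ x).
Qed.

Definition commutator_op H (S T : H -> H) : H -> H :=
  fun x => S (T x) - T (S x).

Definition normal_op H (T : H -> H) : Prop := commute_op (adjoint T) T.

(* [M i j] is the entry in row [i] and column [j] of an operator matrix acting
   on the direct sum of [n] copies of [H]. *)
Definition positive_opmx H n (M : 'I_n -> 'I_n -> H -> H) : Prop :=
  forall x : 'I_n -> H, 0 <= \sum_i '[\sum_j M i j (x j), x i].

Definition hyponormal H n (S : n.-tuple (H -> H)) : Prop :=
  positive_opmx (fun i j => commutator_op (adjoint (tnth S j)) (tnth S i)).

Definition normal_tuple H n (N : n.-tuple (H -> H)) : Prop :=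
  [/\ forall i, bounded_op (tnth N i),
      forall i j, commute_op (tnth N i) (tnth N j) &
      forall i, normal_op (tnth N i)].

(* The inclusion of [H] in a larger Hilbert space [K] is rendered as a linear
   isometric embedding [V]; the intertwining relation says both that each
   [tnth N i] leaves the copy of [H] invariant and that it restricts there to
   [tnth S i]. *)
Definition subnormal H n (S : n.-tuple (H -> H)) : Prop :=
  exists (K : hilbertType R) (V : H -> K) (N : n.-tuple (K -> K)),
    [/\ linear V,
        forall x y, '[V x, V y] = '[x, y],
        normal_tuple N &
        forall i x, tnth N i (V x) = V (tnth S i x)].

(* The exponents [(i, j)] with [1 <= i + j <= k], in the order
   (1,0), (0,1), (2,0), (1,1), (0,2), ..., (k,0), ..., (0,k). *)
Definition exponents (k : nat) : seq (nat * nat) :=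
  [seq ((d - j)%N, j) | d <- iota 1 k, j <- iota 0 d.+1].

Definition monomial H (T1 T2 : H -> H) (p : nat * nat) : H -> H :=
  iter p.2 T2 \o iter p.1 T1.

Definition monomials H (T1 T2 : H -> H) (k : nat) :
    (size (exponents k)).-tuple (H -> H) :=
  map_tuple (monomial T1 T2) (in_tuple (exponents k)).

Definition k_hyponormal H (T1 T2 : H -> H) (k : nat) : Prop :=
  hyponormal (monomials T1 T2 k).

End Operators.

(* Main.v *)
From HB Require Import structures.
Require Import Defs.
From mathcomp Require Import all_boot all_order all_algebra.
From mathcomp Require Import all_classical all_reals all_analysis.
From mathcomp Require Import cyclic separable cyclotomic complex.
From mathcomp Require Import ring lra zify.

Set Implicit Arguments.
Unset Strict Implicit.
Unset Printing Implicit Defensive.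

(* Write N for a normal extension of T and T^a for the monomials.  By Fuglede's
   theorem the N_i^* commute with the N_j, so that, V being the embedding,
   sum <T^a x_b, T^b x_a> = |sum N^{a*} V x_a|^2, and V^* turns this into
   hyponormality of every T(k).  Conversely a Schur complement turns
   k-hyponormality for all k into positivity of the kernel
     k((b, x), (a, y)) = <T^a x, T^b y>   on the set N^2 * H,
   which is the Gram matrix of the vectors N^{*b} x of the extension to be
   constructed.  In the reproducing kernel Hilbert space of k the operators N_i
   and N_i^* are composition with (a, y) |-> (a + e_i, y) and
   (a, y) |-> (a, T_i y); these maps commute, and composition is bounded because
   |N_i^n f|^2 is log-convex in n and O(|T_i|^(2n)). *)

Import Order.TTheory GRing.Theory Num.Theory.
Import numFieldNormedType.Exports.

Local Open Scope classical_set_scope.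
Local Open Scope ring_scope.
Local Notation "''[' x , y ]" := (dot x y) : ring_scope.
Local Notation Re := complex.Re.

(** * Complex and real preliminaries *)

(** The Hilbert space of a kernel is built without quotient or completion. Its elements are the
    functions [phi] for which 2 Re <phi, g> - |g|^2 stays bounded over the formal combinations [g],
    and the supremum is |phi|^2. A combination of seminorm zero is then just the zero function, and
    completeness comes from pointwise limits. The price is that only a norm is available at first:
    the inner product has to be recovered from the parallelogram law. The main obstacle is
    boundedness. Positivity of the kernel alone gives no bound on the candidate operators, and a
    crude estimate controls each entry of the kernel only up to a constant that depends on the
    points. Normality, read as an identity between Gram sums before any operator exists, is what
    removes these constants and leaves the common rate. All [k] are needed because a finite
    combination may involve exponents of any degree. *)

Section ComplexFacts.
Variable R : realType.
Implicit Types z w : R[i].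

Lemma conjCE (a b : R) : ((a +i* b)%C)^* = (a -i* b)%C :> R[i].
Proof. by []. Qed.
Lemma conjCD z w : (z + w)^* = z^* + w^*. Proof. exact: rmorphD. Qed.
Lemma conjCM z w : (z * w)^* = z^* * w^*. Proof. exact: rmorphM. Qed.
Lemma conjC_sum I (r : seq I) (F : I -> R[i]) :
  (\sum_(i <- r) F i)^* = \sum_(i <- r) (F i)^*.
Proof. exact: (rmorph_sum (@Num.conj R[i])). Qed.
Lemma conjC_R (r : R) : (r%:C%C)^* = r%:C%C :> R[i].
Proof. by rewrite conj_Creal// complex_real. Qed.
Lemma cReD z w : Re (z + w) = Re z + Re w. Proof. by case: z w => ? ? []. Qed.
Lemma cReN z : Re (- z) = - Re z. Proof. by case: z. Qed.
Lemma cReB z w : Re (z - w) = Re z - Re w. Proof. by rewrite cReD cReN. Qed.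
Lemma cRe_conj z : Re z^* = Re z. Proof. by case: z. Qed.
Lemma cReRM (r : R) z : Re (r%:C%C * z) = r * Re z.
Proof. by case: z => ? ? /=; ring. Qed.
Lemma cRe_sum I (r : seq I) (F : I -> R[i]) :
  Re (\sum_(i <- r) F i) = \sum_(i <- r) Re (F i).
Proof. by rewrite raddf_sum. Qed.
Lemma normC2E z : z * z^* = (Re (z * z^*))%:C%C.
Proof. by rewrite RRe_real// -normCK ger0_real// exprn_ge0. Qed.
Lemma cRe_normC2 z : Re (z * z^*) = Re z ^+ 2 + complex.Im z ^+ 2.
Proof. by case: z => ? ? /=; ring. Qed.

End ComplexFacts.

(* An additive bounded function is linear: [F t - t * F 1] is additive,
   1-periodic and bounded. *)
Lemma bounded_additive_linear (R : realType) (F : R -> R) (M : R) :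
  (forall s t, F (s + t) = F s + F t) ->
  (forall t, 0 <= t <= 1 -> `|F t| <= M) -> forall t, F t = t * F 1.
Proof.
move=> FD FM; pose G t := F t - t * F 1.
have GD s t : G (s + t) = G s + G t by rewrite /G FD; ring.
have G0 : G 0 = 0 by have := GD 0 0; rewrite addr0 => ?; lra.
have G1 : G 1 = 0 by rewrite /G mul1r subrr.
have Gn (n : nat) t : G (n%:R * t) = n%:R * G t.
  elim: n => [|n IH]; first by rewrite !mul0r.
  by rewrite -natr1 !mulrDl !mul1r GD IH.
have GN t : G (- t) = - G t.
  by have := GD t (- t); rewrite subrr G0 => ?; lra.
have Gz (z : int) : G z%:~R = 0.
  have Gk (k : nat) : G k%:R = 0 by rewrite -[k%:R]mulr1 Gn G1 mulr0.
  by case: z => k; rewrite ?NegzE ?mulrNz ?GN -pmulrn Gk ?oppr0.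
have Gb t : `|G t| <= M + `|F 1|.
  have -> : G t = G (t - (Num.floor t)%:~R) by rewrite GD GN Gz oppr0 addr0.
  have /andP[t0 t1] : 0 <= t - (Num.floor t)%:~R <= 1.
    have := floor_le t; have := floorD1_gt t.
    by rewrite intrD => ? ?; apply/andP; split; lra.
  apply: (le_trans (ler_normB _ _)); rewrite lerD// ?FM ?t0//.
  by rewrite normrM ger0_norm// ler_piMl.
move=> t; apply/eqP; rewrite -subr_eq0 -[_ - _]/(G t) -normr_eq0.
rewrite eq_le normr_ge0 andbT leNgt; apply/negP => Gt.
pose n := Num.truncn ((M + `|F 1|) / `|G t|).
have := Gb (n.+1%:R * t); rewrite Gn normrM ger0_norm//.
by rewrite -ler_pdivlMr// leNgt truncnS_gt.
Qed.

(** * Hilbert spaces *)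

Section HilbertFacts.
Variables (R : realType) (H : hilbertType R).
Implicit Types (x y z : H) (a : R[i]).

Lemma dotC x y : '[x, y] = '[y, x]^*.
Proof. by rewrite hermC expr0 mul1r. Qed.
Lemma dotDl x y z : '[x + y, z] = '[x, z] + '[y, z].
Proof. exact: linearDl. Qed.
Lemma dotDr x y z : '[z, x + y] = '[z, x] + '[z, y].
Proof. exact: linearDr. Qed.
Lemma dotZl a x y : '[a *: x, y] = a * '[x, y]. Proof. exact: linearZl_LR. Qed.
Lemma dotZr a x y : '[x, a *: y] = a^* * '[x, y].
Proof. exact: (linearZr_LR dot). Qed.
Lemma dotNl x y : '[- x, y] = - '[x, y]. Proof. exact: linearNl. Qed.
Lemma dotNr x y : '[x, - y] = - '[x, y]. Proof. exact: linearNr. Qed.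
Lemma dotBl x y z : '[x - y, z] = '[x, z] - '[y, z].
Proof. by rewrite dotDl dotNl. Qed.
Lemma dotBr x y z : '[z, x - y] = '[z, x] - '[z, y].
Proof. by rewrite dotDr dotNr. Qed.
Lemma dot0l x : '[0, x] = 0. Proof. exact: linear0l. Qed.
Lemma dot0r x : '[x, 0] = 0. Proof. exact: linear0r. Qed.
Lemma dot_suml I (r : seq I) (F : I -> H) x :
  '[\sum_(i <- r) F i, x] = \sum_(i <- r) '[F i, x].
Proof. by elim/big_ind2: _ => [|? ? ? ? <- <-|//]; rewrite ?dot0l ?dotDl. Qed.
Lemma dot_sumr I (r : seq I) (F : I -> H) x :
  '[x, \sum_(i <- r) F i] = \sum_(i <- r) '[x, F i].
Proof. by elim/big_ind2: _ => [|? ? ? ? <- <-|//]; rewrite ?dot0r ?dotDr. Qed.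

Lemma dot_ge0 x : 0 <= '[x, x]. Proof. by rewrite -normr_dot exprn_ge0. Qed.

Lemma dot_eq0 x : ('[x, x] == 0) = (x == 0).
Proof. by rewrite -normr_dot sqrf_eq0 normr_eq0. Qed.

Lemma dot_extr y z : (forall x, '[x, y] = '[x, z]) -> y = z.
Proof.
by move=> yz; apply/eqP; rewrite -subr_eq0 -dot_eq0 dotBr yz subrr.
Qed.

Lemma dot_extl y z : (forall x, '[y, x] = '[z, x]) -> y = z.
Proof. by move=> yz; apply: dot_extr => x; rewrite dotC yz -dotC. Qed.

Lemma dot_CauchySchwarz x y : `|'[x, y]| <= `|x| * `|y|.
Proof.
have [->|y0] := eqVneq y 0; first by rewrite dot0r normr0 mulr_ge0.
have yy : 0 < '[y, y] by rewrite lt_def dot_eq0 y0 dot_ge0.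
rewrite -(ler_pXn2r (n := 2)) ?nnegrE ?mulr_ge0// exprMn !normr_dot.
have := dot_ge0 (x - ('[x, y] / '[y, y]) *: y).
rewrite !(dotBl, dotBr, dotZl, dotZr) (dotC y x) !conjCM.
have yyc : '[y, y]^* = '[y, y] by rewrite -dotC.
rewrite rmorphV ?unitfE ?gt_eqF//= yyc normCK.
rewrite -(pmulr_lge0 _ yy) -subr_ge0; congr (_ <= _).
by field; rewrite gt_eqF.
Qed.

(** The norm of a module over [R[i]] has values in [R[i]]; this is the same number in [R], where
    order, suprema and [expR] live. *)
Definition rnorm x : R := Re `|x|.

Lemma normrE x : `|x| = (rnorm x)%:C%C.
Proof. by rewrite /rnorm RRe_real ?normr_real. Qed.

Lemma rnorm_ge0 x : 0 <= rnorm x.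
Proof. by rewrite -ler0c -normrE. Qed.

Lemma rnorm_sqr x : rnorm x ^+ 2 = Re '[x, x].
Proof. by rewrite -normr_dot normrE -rmorphXn. Qed.

Lemma rnormD x y : rnorm (x + y) <= rnorm x + rnorm y.
Proof. by rewrite -lecR rmorphD /= -!normrE ler_normD. Qed.

Lemma rnormN x : rnorm (- x) = rnorm x.
Proof. by rewrite /rnorm normrN. Qed.

Lemma rnormB x y : rnorm (x - y) <= rnorm x + rnorm y.
Proof. by rewrite -(rnormN y) rnormD. Qed.

Lemma rnormZ a x : rnorm (a *: x) = Re `|a| * rnorm x.
Proof. by rewrite /rnorm normrZ -[in LHS](RRe_real (normr_real a)) cReRM. Qed.

Lemma rnormZR (r : R) x : 0 <= r -> rnorm (r%:C%C *: x) = r * rnorm x.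
Proof. by move=> r0; rewrite rnormZ ger0_norm ?ler0c. Qed.

Lemma rnormD_sqr x y :
  rnorm (x + y) ^+ 2 = rnorm x ^+ 2 + rnorm y ^+ 2 + 2 * Re '[x, y].
Proof.
rewrite !rnorm_sqr dotDl !dotDr !cReD (dotC y x) cRe_conj; ring.
Qed.

Lemma rnorm_dot x y : `|'[x, y]| <= (rnorm x * rnorm y)%:C%C.
Proof. by rewrite rmorphM /= -!normrE dot_CauchySchwarz. Qed.

Lemma le_rnorm x y (M : R) : (`|x| <= M%:C%C * `|y|) = (rnorm x <= M * rnorm y).
Proof. by rewrite !normrE -rmorphM lecR. Qed.

End HilbertFacts.

Section BoundedOperators.
Variables (R : realType).
Implicit Types H K : hilbertType R.

Lemma bounded_op_ge0 H (T : H -> H) : bounded_op T ->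
  exists2 M : R, 0 <= M & forall x, `|T x| <= M%:C%C * `|x|.
Proof.
move=> [_ [M TM]]; exists (Re `|M|).
  by have := normr_ge0 M; rewrite lecE => /andP[].
move=> x; rewrite RRe_real ?normr_real//.
have := TM x => h; have h0 := le_trans (normr_ge0 _) h.
by rewrite -(ger0_norm h0) normrM normr_id in h.
Qed.

Lemma bounded_op_rnorm H (T : H -> H) : bounded_op T ->
  exists2 M : R, 0 <= M & forall x, rnorm (T x) <= M * rnorm x.
Proof.
by case/bounded_op_ge0 => M M0 hM; exists M => // x; rewrite -le_rnorm.
Qed.

Lemma linear_opD H K (T : H -> K) : linear T ->
  forall x y, T (x + y) = T x + T y.
Proof. by move=> lT x y; rewrite -{1}(scale1r x) lT scale1r. Qed.

Lemma linear_op0 H K (T : H -> K) : linear T -> T 0 = 0.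
Proof. by move=> lT; apply/(addrI (T 0)); rewrite -linear_opD// !addr0. Qed.

Lemma linear_opZ H K (T : H -> K) : linear T ->
  forall a x, T (a *: x) = a *: T x.
Proof. by move=> lT a x; rewrite -[a *: x]addr0 lT linear_op0// addr0. Qed.

Lemma linear_opB H K (T : H -> K) : linear T ->
  forall x y, T (x - y) = T x - T y.
Proof.
by move=> lT x y; rewrite -scaleN1r linear_opD// linear_opZ// scaleN1r.
Qed.

Lemma linear_op_sum H K (T : H -> K) : linear T ->
  forall I (r : seq I) (F : I ->
    H), T (\sum_(i <- r) F i) = \sum_(i <- r) T (F i).
Proof.
move=> lT I r F; elim/big_ind2: _ => [|x y z t <- <-|//];
  first exact: linear_op0.
exact: linear_opD.
Qed.

Lemma adjoint_dot H (T : H -> H) : bounded_op T ->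
  forall x y, '[adjoint T x, y] = '[x, T y].
Proof. by move=> bT x y; rewrite dotC -adjointP// -dotC. Qed.

Lemma adjoint_bounded H (T : H -> H) : bounded_op T -> bounded_op (adjoint T).
Proof.
move=> bT; split.
  move=> a u v; apply: dot_extr => x; rewrite -adjointP// dotDr dotZr.
  by rewrite dotDr dotZr -!adjointP.
have [M M0 TM] := bounded_op_ge0 bT; exists (M%:C%C) => y.
have [->|ny0] := eqVneq `|adjoint T y| 0; first by rewrite mulr_ge0 ?ler0c.
have ny : 0 < `|adjoint T y| by rewrite lt_def ny0 normr_ge0.
rewrite -(ler_pM2l ny) -expr2 normr_dot -(ger0_norm (dot_ge0 _)) -adjointP//.
apply: le_trans (dot_CauchySchwarz _ _) _.
by rewrite mulrA (mulrC _ M%:C%C) ler_wpM2r.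
Qed.

End BoundedOperators.

(** * Reproducing kernel Hilbert spaces *)

Record posdef_kernel (R : realType) (X : Type) := PosdefKernel {
  kernel_fun :> X -> X -> R[i];
  kernel_herm : forall x y, kernel_fun y x = (kernel_fun x y)^*;
  kernel_pos : forall g : seq (R[i] * X),
    0 <= \sum_(p <- g) \sum_(q <- g) p.1 * q.1^* * kernel_fun p.2 q.2 }.

(** * Formal combinations and the dual norm *)

Section Combinations.
Variables (R : realType) (X : Type).
Local Notation C := R[i].
Implicit Types (phi psi : X -> C) (g h : seq (C * X)) (c : C).

(* [g : seq (C * X)] stands for the formal combination [\sum_p p.1 k_p.2] of
   reproducing elements, and [pairing phi g] for its inner product with [phi].
   *)
Definition pairing phi g : C := \sum_(p <- g) p.1^* * phi p.2.

Definition rescale c g : seq (C * X) := [seq (c * p.1, p.2) | p <- g].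

Lemma pairingD phi psi g :
  pairing (phi + psi) g = pairing phi g + pairing psi g.
Proof. by rewrite -big_split; apply: eq_bigr => p _; exact: mulrDr. Qed.

Lemma pairingZ c phi g : pairing (c *: phi) g = c * pairing phi g.
Proof.
by rewrite big_distrr /=; apply: eq_bigr => p _; rewrite mulrCA.
Qed.

Lemma pairingN phi g : pairing (- phi) g = - pairing phi g.
Proof. by rewrite -scaleN1r pairingZ mulN1r. Qed.

Lemma pairing0 g : pairing 0 g = 0.
Proof. by rewrite -(scale0r 0) pairingZ mul0r. Qed.

Lemma pairing_cat phi g h : pairing phi (g ++ h) =
  pairing phi g + pairing phi h.
Proof. exact: big_cat. Qed.

Lemma pairing_rescale c phi g : pairing phi (rescale c g) = c^* * pairing phi g.
Proof.
rewrite /pairing big_map big_distrr; apply: eq_bigr => p _ /=.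
by rewrite conjCM mulrA.
Qed.

Variable k : posdef_kernel R X.

Definition combination g : X -> C := fun y => \sum_(p <- g) p.1 * k p.2 y.

Lemma combination_cat g h : combination (g ++ h) =
  combination g + combination h.
Proof. by apply/funext => y; rewrite /combination big_cat. Qed.

Lemma combination_rescale c g : combination (rescale c g) = c *: combination g.
Proof.
apply/funext => y; rewrite /combination big_map [RHS]big_distrr.
by apply: eq_bigr => p _ /=; rewrite mulrA.
Qed.

Lemma pairing_combC g h :
  pairing (combination g) h = (pairing (combination h) g)^*.
Proof.
transitivity (\sum_(q <- h) \sum_(p <- g) p.1 * q.1^* * k p.2 q.2).
  apply: eq_bigr => q _; rewrite big_distrr; apply: eq_bigr => p _ /=; ring.
rewrite exchange_big conjC_sum; apply: eq_bigr => p _ /=.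
rewrite conjCM conjCK conjC_sum big_distrr; apply: eq_bigr => q _ /=.
by rewrite conjCM -kernel_herm mulrA.
Qed.

Definition gram g : R := Re (pairing (combination g) g).

Lemma gram_ge0 g : 0 <= gram g.
Proof.
have := kernel_pos k g; rewrite lecE /= => /andP[_].
rewrite exchange_big; congr (_ <= Re _); apply: eq_bigr => q _ /=.
by rewrite big_distrr; apply: eq_bigr => p _ /=; ring.
Qed.

Lemma gramE g : pairing (combination g) g = (gram g)%:C%C.
Proof.
rewrite /gram RRe_real//; apply/CrealP; exact/esym/pairing_combC.
Qed.

Lemma gram_cat g h :
  gram (g ++ h) = gram g + gram h + 2 * Re (pairing (combination g) h).
Proof.
rewrite /gram combination_cat !pairingD !pairing_cat !cReD.
by rewrite (pairing_combC h g) cRe_conj; ring.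
Qed.

Lemma gram_rescale c g : gram (rescale c g) = Re (c * c^*) * gram g.
Proof.
rewrite {1}/gram combination_rescale pairingZ pairing_rescale gramE mulrA.
by rewrite mulrC cReRM mulrC.
Qed.

(** In the space to be built this equals |phi|^2 - |phi - g|^2, so its supremum over a dense set of
    [g] is |phi|^2. Unlike the quotient of |<phi, g>|^2 by |g|^2, it makes sense when [gram g]
    vanishes. *)
Definition dual_form phi g : R := 2 * Re (pairing phi g) - gram g.

Definition kernel_bounded phi := exists M, forall g, dual_form phi g <= M.

(* For bounded [phi] the square of its norm in the dual of the space of formal
   combinations. *)
Definition energy phi : R := sup (range (dual_form phi)).

Lemma energy_has_sup phi : kernel_bounded phi ->
  has_sup (range (dual_form phi)).
Proof.
move=> [M hM]; split; first by exists (dual_form phi [::]), [::].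
by exists M => _ [g _ <-].
Qed.

Lemma energy_ub phi g : kernel_bounded phi -> dual_form phi g <= energy phi.
Proof.
by move=> /energy_has_sup[_ hs]; apply: ub_le_sup => //; exists g.
Qed.

Lemma energy_le phi M :
  (forall g, dual_form phi g <= M) -> energy phi <= M.
Proof.
move=> hM; apply: ge_sup; last by move=> _ [g _ <-].
by exists (dual_form phi [::]), [::].
Qed.

Lemma energy_ge0 phi : kernel_bounded phi -> 0 <= energy phi.
Proof.
move=> /(energy_ub [::]); apply: le_trans.
by rewrite /dual_form /gram /pairing !big_nil mulr0 subrr.
Qed.

(** The parallelogram law at the level of test combinations: [phi] is tested on (g + h)/2 and [psi]
    on (g - h)/2. *)
Lemma dual_formDB phi psi g h :
  dual_form (phi + psi) g + dual_form (phi - psi) h =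
  2 * dual_form phi (rescale 2^-1 (g ++ h)) +
  2 * dual_form psi (rescale 2^-1 (g ++ rescale (-1) h)).
Proof.
have half : 2^-1 = (2^-1 : R)%:C%C :> C by rewrite fmorphV rmorph_nat.
rewrite /dual_form !gram_rescale !gram_cat gram_rescale !pairing_rescale.
rewrite !pairing_cat !pairing_rescale pairingD (pairingD _ (- psi)) pairingN.
rewrite half conjC_R !cReRM /= rmorphN1 !mulN1r.
by rewrite !(cReB, cReD, cReN) /=; field.
Qed.

Lemma kernel_bounded0 : kernel_bounded 0.
Proof.
by exists 0 => g; rewrite /dual_form pairing0 mulr0 sub0r oppr_le0 gram_ge0.
Qed.

Lemma energy0 : energy 0 = 0.
Proof.
apply/eqP; rewrite eq_le (energy_ge0 kernel_bounded0) andbT.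
apply: energy_le => g.
by rewrite /dual_form pairing0 mulr0 sub0r oppr_le0 gram_ge0.
Qed.

Lemma dual_formZ c phi g : c != 0 ->
  dual_form (c *: phi) g = Re (c * c^*) * dual_form phi (rescale c^-1 g).
Proof.
move=> c0; rewrite /dual_form pairingZ pairing_rescale gram_rescale.
have e1 : c * c^* * c^-1^* = c.
  by rewrite -mulrA -conjCM divff// conjC1 mulr1.
have e2 : Re (c * c^*) * Re (c^-1 * c^-1^*) = 1.
  by rewrite -cReRM -normC2E mulrACA divff// mul1r -conjCM divff// conjC1.
rewrite mulrBr (mulrA (Re _) (Re _)) e2 mul1r mulrCA.
rewrite -(cReRM (Re (c * c^*))) -normC2E.
by rewrite mulrA e1.
Qed.

Lemma kernel_boundedZ c phi : kernel_bounded phi -> kernel_bounded (c *: phi).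
Proof.
have [->|c0] := eqVneq c 0; first by rewrite scale0r => _;
  exact: kernel_bounded0.
move=> [M hM]; exists (Re (c * c^*) * M) => g.
by rewrite dual_formZ// ler_wpM2l// cRe_normC2 addr_ge0 ?sqr_ge0.
Qed.

Lemma energyZ c phi : kernel_bounded phi ->
  energy (c *: phi) = Re (c * c^*) * energy phi.
Proof.
move=> bphi; have [->|c0] := eqVneq c 0.
  by rewrite scale0r mul0r energy0 mul0r.
have le d psi : d != 0 -> kernel_bounded psi ->
    energy (d *: psi) <= Re (d * d^*) * energy psi.
  move=> d0 bpsi; apply: energy_le => g; rewrite dual_formZ//.
  by rewrite ler_wpM2l ?energy_ub// cRe_normC2 addr_ge0 ?sqr_ge0.
apply/eqP; rewrite eq_le le//=.
have := le c^-1 _ (invr_neq0 c0) (kernel_boundedZ c bphi).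
rewrite scalerA mulVf// scale1r => h.
have c2 : Re (c * c^*) * Re (c^-1 * c^-1^*) = 1.
  by rewrite -cReRM -normC2E mulrACA divff// mul1r -conjCM divff// conjC1.
rewrite -[leRHS]mul1r -c2 -mulrA ler_wpM2l//.
by rewrite cRe_normC2 addr_ge0 ?sqr_ge0.
Qed.

Lemma kernel_boundedDB phi psi : kernel_bounded phi -> kernel_bounded psi ->
  forall g h, dual_form (phi + psi) g + dual_form (phi - psi) h <=
              2 * energy phi + 2 * energy psi.
Proof.
move=> bphi bpsi g h; rewrite dual_formDB lerD// ler_wpM2l// energy_ub//.
Qed.

Lemma kernel_boundedD phi psi : kernel_bounded phi -> kernel_bounded psi ->
  kernel_bounded (phi + psi).
Proof.
move=> bphi bpsi; exists (2 * energy phi + 2 * energy psi) => g.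
have := kernel_boundedDB bphi bpsi g [::]; rewrite [X in _ + X]/dual_form.
by rewrite /gram /pairing !big_nil /= mulr0 subrr addr0.
Qed.

(** Suprema in [dual_formDB] give one inequality. The other is the same inequality for [phi + psi]
    and [phi - psi], whose sum and difference are twice [phi] and twice [psi]. *)
Lemma energy_parallelogram phi psi : kernel_bounded phi -> kernel_bounded psi ->
  energy (phi + psi) + energy (phi - psi) = 2 * energy phi + 2 * energy psi.
Proof.
have le u v : kernel_bounded u -> kernel_bounded v ->
    energy (u + v) + energy (u - v) <= 2 * energy u + 2 * energy v.
  move=> bu bv; rewrite -lerBrDr; apply: energy_le => g.
  rewrite lerBrDr -lerBrDl; apply: energy_le => h.
  by rewrite lerBrDl kernel_boundedDB.
move=> bphi bpsi; apply/eqP; rewrite eq_le le//=.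
have bN u : kernel_bounded u -> kernel_bounded (- u).
  by rewrite -scaleN1r; exact: kernel_boundedZ.
have := le _ _ (kernel_boundedD bphi bpsi) (kernel_boundedD bphi (bN _ bpsi)).
have -> : phi + psi + (phi - psi) = 2%:R *: phi.
  by rewrite scaler_nat mulr2n addrACA (subrr psi) addr0.
have -> : phi + psi - (phi - psi) = 2%:R *: psi.
  by rewrite scaler_nat mulr2n opprB (addrC phi) addrACA (subrr phi) addr0.
rewrite !energyZ//.
have -> : Re ((2%:R : C) * 2%:R^*) = 4 by rewrite conjC_nat -natrM.
by lra.
Qed.

Lemma combination_bounded g : kernel_bounded (combination g).
Proof.
exists (gram g) => h; rewrite /dual_form.
have := gram_ge0 (g ++ rescale (-1) h).
rewrite gram_cat gram_rescale pairing_rescale rmorphN1 mulrNN mulr1 mulN1r cReN.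
by rewrite /=; lra.
Qed.

(** Testing on f - g instead of f gives one inequality; undoing the translation by -g gives the
    other. The reproducing property [dot_comb] and the density of combinations both come from this
    expansion. *)
Lemma energy_translate phi g : kernel_bounded phi ->
  energy (phi + combination g) = energy phi + 2 * Re (pairing phi g) + gram g.
Proof.
have le psi h : kernel_bounded psi ->
    energy (psi + combination h) <=
      energy psi + 2 * Re (pairing psi h) + gram h.
  move=> bpsi; apply: energy_le => f.
  have := energy_ub (f ++ rescale (-1) h) bpsi; rewrite /dual_form.
  rewrite gram_cat gram_rescale pairing_cat !pairing_rescale pairingD !cReD.
  rewrite (pairing_combC h f) cRe_conj.
  by rewrite rmorphN1 mulrNN mulr1 !mulN1r !cReN /=; lra.
move=> bphi; apply/eqP; rewrite eq_le le//=.
have bpg : kernel_bounded (phi + combination g).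
  by apply: kernel_boundedD => //; exact: combination_bounded.
have := le _ (rescale (-1) g) bpg.
rewrite combination_rescale scaleN1r addrK gram_rescale pairing_rescale.
rewrite pairingD rmorphN1 mulrNN mulr1 mulN1r cReN cReD -/(gram g) /=.
by lra.
Qed.

Lemma energy_point phi x : kernel_bounded phi ->
  Re (phi x * (phi x)^*) <= (1 + Re (k x x)) * energy phi.
Proof.
move=> bphi; have kx : 0 <= Re (k x x).
  have := gram_ge0 [:: (1, x)];
    rewrite /gram /pairing /combination !big_seq1 /=.
  by rewrite conjC1 !mul1r.
(* The test combination is t phi(x) at the single point [x]. The summand 1 avoids a separate case
   for k(x, x) = 0. *)
pose t := (1 + Re (k x x))^-1.
have t0 : 0 < t by rewrite invr_gt0 ltr_pwDl.
have tk : t * Re (k x x) = 1 - t by rewrite /t; field;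
  rewrite gt_eqF// ltr_pwDl.
have := energy_ub [:: (t%:C%C * phi x, x)] bphi.
rewrite /dual_form /gram /pairing /combination !big_seq1 /=.
set z := phi x; rewrite conjCM conjC_R -!mulrA !cReRM.
have -> : Re (z^* * (t%:C%C * (z * k x x))) = t * Re (z * z^*) * Re (k x x).
  rewrite mulrCA cReRM (mulrA z^*) (mulrC z^*) normC2E cReRM /=; ring.
rewrite (mulrC z^*) -ler_pdivrMl ?ltr_pwDl// -/t.
have : 0 <= Re (z * z^*) by rewrite cRe_normC2 addr_ge0 ?sqr_ge0.
move: (Re (z * _)) (energy phi) (Re (k x x)) tk t0 => a e q tk t0 a0.
have -> : t * (t * a * q) = t * a * (t * q) by ring.
by rewrite tk; nra.
Qed.

End Combinations.

(** * The inner product on functions of finite energy *)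

Section KernelSpace.
Variables (R : realType) (X : Type) (k : posdef_kernel R X).
Local Notation C := R[i].

Definition kernel_space_pred : {pred X -> C} :=
  fun phi => `[< kernel_bounded k phi >].

Fact kernel_space_submod : submod_closed kernel_space_pred.
Proof.
split=> [|c phi psi]; first exact/asboolP/kernel_bounded0.
move=> /asboolP bphi /asboolP bpsi; apply/asboolP/kernel_boundedD => //.
exact: kernel_boundedZ.
Qed.

HB.instance Definition _ :=
  GRing.isSubmodClosed.Build C (X -> C) kernel_space_pred kernel_space_submod.

Record kernel_space := KernelSpace {
  kernel_space_val :> X -> C;
  _ : kernel_space_val \in kernel_space_pred }.

HB.instance Definition _ := [isSub for kernel_space_val].
HB.instance Definition _ := [Choice of kernel_space by <:].
HB.instance Definition _ := [SubChoice_isSubLmodule of kernel_space by <:].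

Implicit Types u v w : kernel_space.

Lemma kernel_spaceP u : kernel_bounded k u.
Proof. by apply/asboolP; exact: (valP u). Qed.

Definition nrm2 u : R := energy k u.

Lemma nrm2_ge0 u : 0 <= nrm2 u.
Proof. by apply: energy_ge0; exact: kernel_spaceP. Qed.

Lemma nrm2_parallelogram u v :
  nrm2 (u + v) + nrm2 (u - v) = 2 * nrm2 u + 2 * nrm2 v.
Proof. by apply: energy_parallelogram; exact: kernel_spaceP. Qed.

Lemma nrm2Z c u : nrm2 (c *: u) = complex.Re (c * c^*) * nrm2 u.
Proof. by apply: energyZ; exact: kernel_spaceP. Qed.

Lemma nrm2N u : nrm2 (- u) = nrm2 u.
Proof. by rewrite -scaleN1r nrm2Z rmorphN1 mulrNN mulr1 /= mul1r. Qed.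

Lemma nrm20 : nrm2 0 = 0. Proof. exact: energy0. Qed.

Lemma nrm2_point u x :
  Re (u x * (u x)^*) <= (1 + Re (k x x)) * nrm2 u.
Proof. by apply: energy_point; exact: kernel_spaceP. Qed.

Lemma nrm2_eq0 u : nrm2 u = 0 -> u = 0.
Proof.
move=> u0; apply/val_inj/funext => x; have := nrm2_point u x.
rewrite u0 mulr0 cRe_normC2 => h; suff : u x = 0 by [].
apply/eqP; rewrite eq_complex /= -(sqrf_eq0 (Re _)) -(sqrf_eq0 (complex.Im _)).
by rewrite -paddr_eq0 ?sqr_ge0// eq_le h addr_ge0 ?sqr_ge0.
Qed.

(* Additivity of [rdot] is the Jordan-von Neumann argument. *)
Definition rdot u v : R := (nrm2 (u + v) - nrm2 (u - v)) / 4.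

Lemma rdotC u v : rdot u v = rdot v u.
Proof. by rewrite /rdot (addrC u) -(nrm2N (u - v)) opprB. Qed.

Lemma rdot0l v : rdot 0 v = 0.
Proof. by rewrite /rdot add0r sub0r nrm2N subrr mul0r. Qed.

Lemma rdotDl u v w : rdot (u + v) w = rdot u w + rdot v w.
Proof.
(* Subtract the parallelogram laws for (a + c, b + c) and (a - c, b - c), which share the difference
   a - b. Using the result for (u + v, 0) and for (u, v) then gives additivity. *)
have half a b c : rdot a c + rdot b c = rdot (a + b) (c + c) / 2.
  have h1 := nrm2_parallelogram (a + c) (b + c).
  have h2 := nrm2_parallelogram (a - c) (b - c).
  have e1 : a + c - (b + c) = a - b by rewrite opprD addrACA subrr addr0.
  have e2 : a - c - (b - c) = a - b by rewrite opprB addrA subrK.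
  move: h1 h2; rewrite e1 e2 (addrACA a c) (addrACA a (- c)) -opprD /rdot.
  by move: (nrm2 _) => *; lra.
have := half (u + v) 0 w; rewrite addr0 rdot0l addr0.
by move=> ->; rewrite -half.
Qed.

Lemma rdot_bound u v : `|rdot u v| <= (nrm2 u + nrm2 v) / 2.
Proof.
have := nrm2_parallelogram u v; have := nrm2_ge0 (u + v).
have := nrm2_ge0 (u - v); rewrite /rdot ler_norml => *; apply/andP; split; lra.
Qed.

(** Additivity alone yields rational scalars only; [rdot_bound] keeps the function of [t] bounded on
    [0, 1], and this forces real linearity. *)
Lemma rdotZl (t : R) u v : rdot (t%:C%C *: u) v = t * rdot u v.
Proof.
rewrite -[in RHS](scale1r u).
apply: (@bounded_additive_linear _ (fun t : R => rdot (t%:C%C *: u) v)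
  ((nrm2 u + nrm2 v) / 2)) => [a b|a /andP[a0 a1]].
  by rewrite rmorphD scalerDl rdotDl.
apply: (le_trans (rdot_bound _ _)); rewrite ler_pM2r// lerD2r nrm2Z conjC_R.
rewrite -rmorphM ler_piMl ?nrm2_ge0//=.
by rewrite mulr_ile1.
Qed.

Lemma rdotNl u v : rdot (- u) v = - rdot u v.
Proof. by rewrite -scaleN1r -(rmorphN1 (real_complex R)) rdotZl mulN1r. Qed.

Lemma rdotDr u v w : rdot w (u + v) = rdot w u + rdot w v.
Proof. by rewrite rdotC rdotDl !(rdotC w). Qed.

Lemma rdotZr (t : R) u v : rdot u (t%:C%C *: v) = t * rdot u v.
Proof. by rewrite rdotC rdotZl rdotC. Qed.

Lemma rdotii u v : rdot ('i%C *: u) ('i%C *: v) = rdot u v.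
Proof.
have ii : Re ('i%C * 'i%C^* : C) = 1 by move=> /=; ring.
by rewrite /rdot -scalerDr -scalerBr !nrm2Z ii !mul1r.
Qed.

Lemma rdotiC u v : rdot ('i%C *: u) v = - rdot u ('i%C *: v).
Proof.
rewrite -rdotii scalerA -expr2 sqr_i scaleN1r rdotNl; congr (- _).
Qed.

Lemma rdotuu u : rdot u u = nrm2 u.
Proof.
rewrite /rdot subrr nrm20 -mulr2n -(scaler_nat 2) nrm2Z.
have -> : Re ((2%:R : C) * 2%:R^*) = 4 by rewrite conjC_nat -natrM.
by field.
Qed.

(** Polarization: with conjugate-linearity on the right, Re <u, i v> is the imaginary part of <u,
    v>. *)
Definition kdot u v : C := (rdot u v +i* rdot u ('i%C *: v))%C.

Lemma kdotC u v : kdot u v = (kdot v u)^*.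
Proof.
by rewrite conjCE /kdot (rdotC u v) (rdotC v ('i%C *: u)) rdotiC opprK.
Qed.

Lemma scalerCE (c : C) u :
  c *: u = (Re c)%:C%C *: u + (complex.Im c)%:C%C *: ('i%C *: u).
Proof. by rewrite scalerA -scalerDl [_ * 'i%C]mulrC -complexE. Qed.

Lemma kdotDl u v w : kdot (u + v) w = kdot u w + kdot v w.
Proof. by rewrite /kdot !rdotDl. Qed.

Lemma kdotZl c u v : kdot (c *: u) v = c * kdot u v.
Proof.
rewrite scalerCE kdotDl /kdot !rdotZl rdotiC rdotii; case: c => a b /=.
by apply/eqP; rewrite eq_complex /=; apply/andP; split; apply/eqP; ring.
Qed.

Lemma kdotDr u v w : kdot w (u + v) = kdot w u + kdot w v.
Proof. by rewrite kdotC kdotDl conjCD -!kdotC. Qed.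

Lemma kdotZr c u v : kdot u (c *: v) = c^* * kdot u v.
Proof. by rewrite kdotC kdotZl conjCM -kdotC. Qed.

Lemma kdotuu u : kdot u u = (nrm2 u)%:C%C.
Proof.
apply/eqP; rewrite eq_complex /= rdotuu eqxx /=; apply/eqP.
by have := rdotiC u u; rewrite rdotC => ?; lra.
Qed.

Fact kdot_bilinear : bilinear_for *%R (@Num.conj C \; *%R) kdot.
Proof.
by split=> [u c v w|u c v w]; rewrite /= ?kdotDl ?kdotZl ?kdotDr ?kdotZr.
Qed.

HB.instance Definition _ :=
  bilinear_isBilinear.Build C kernel_space kernel_space
  C *%R (@Num.conj C \; *%R) kdot kdot_bilinear.

Fact kdot_herm u v : kdot u v = (-1) ^+ false * (kdot v u)^*.
Proof. by rewrite expr0 mul1r kdotC. Qed.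

HB.instance Definition _ := isHermitianSesquilinear.Build C kernel_space false
  (@Num.conj C) kdot kdot_herm.

Fact kdot_gt0 u : u != 0 -> 0 < kdot u u.
Proof.
move=> u0; rewrite kdotuu ltcR lt_def nrm2_ge0 andbT.
by apply: contraNneq u0 => /nrm2_eq0 ->.
Qed.

HB.instance Definition _ := isDotProduct.Build C kernel_space kdot kdot_gt0.

Definition knorm u : C := (Num.sqrt (nrm2 u))%:C%C.

Lemma rdot_le u v : rdot u v <= Num.sqrt (nrm2 u) * Num.sqrt (nrm2 v).
Proof.
have [v0|v0] := eqVneq (nrm2 v) 0.
  by rewrite (nrm2_eq0 v0) rdotC rdot0l mulr_ge0 ?sqrtr_ge0.
rewrite -sqrtrM ?nrm2_ge0// (le_trans (ler_norm _))// -sqrtr_sqr ler_wsqrtr//.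
have := nrm2_ge0 (u + (- rdot u v / nrm2 v)%:C%C *: v).
rewrite -rdotuu rdotDl !rdotDr !rdotZl !rdotZr !rdotuu (rdotC v u).
have : 0 < nrm2 v by rewrite lt_def v0 nrm2_ge0.
move=> vp h; rewrite -subr_ge0.
rewrite -(pmulr_rge0 _ (_ : 0 < (nrm2 v)^-1)) ?invr_gt0//.
by congr (_ <= _) : h; field.
Qed.

Fact knormD u v : knorm (u + v) <= knorm u + knorm v.
Proof.
rewrite -rmorphD lecR -(ler_pXn2r (n := 2)) ?nnegrE ?addr_ge0 ?sqrtr_ge0//.
rewrite sqrrD !sqr_sqrtr ?nrm2_ge0// -rdotuu rdotDl !rdotDr !rdotuu (rdotC v u).
by have := rdot_le u v; lra.
Qed.

Fact knormZ c u : knorm (c *: u) = `|c| * knorm u.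
Proof.
rewrite /knorm nrm2Z sqrtrM ?rmorphM; last first.
  by rewrite cRe_normC2 addr_ge0 ?sqr_ge0.
by congr (_ * _); rewrite normc_def cRe_normC2.
Qed.

Fact knorm_eq0 u : knorm u = 0 -> u = 0.
Proof.
case=> /eqP; rewrite sqrtr_eq0 => h; apply: nrm2_eq0.
by apply/eqP; rewrite eq_le h nrm2_ge0.
Qed.

HB.instance Definition _ := Lmodule_isNormed.Build C kernel_space
  knormD knormZ knorm_eq0.

Lemma normrKE u : `|u| = (Num.sqrt (nrm2 u))%:C%C. Proof. by []. Qed.

End KernelSpace.

(** * Completeness by pointwise limits *)

Section KernelSpaceComplete.
Variables (R : realType) (X : Type) (k : posdef_kernel R X).
Local Notation C := R[i].
Local Notation K := (kernel_space k).
Implicit Types u v w : K.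

Lemma knorm_lt u (e : R) : 0 < e -> (`|u| < e%:C%C) = (nrm2 u < e ^+ 2).
Proof.
move=> e0; rewrite normrKE ltcR -[LHS](ltr_pXn2r (n := 2))//.
- by rewrite sqr_sqrtr ?nrm2_ge0.
- by rewrite nnegrE sqrtr_ge0.
- by rewrite nnegrE ltW.
Qed.

Lemma real_norm_sqr_lt (a e : R) : 0 < e -> a ^+ 2 < e ^+ 2 -> `|a| < e.
Proof.
by move=> e0; rewrite -real_normK ?num_real// ltr_pXn2r// nnegrE ltW.
Qed.

Lemma kernel_space_cauchy_diam (F : set_system K) : ProperFilter F ->
  cauchy F ->
  forall e : R, 0 < e ->
  exists2 A, F A & forall u v, A u -> A v -> nrm2 (u - v) < e ^+ 2.
Proof.
move=> FF /cauchyP Fc e e0; have e2 : 0 < (e / 2)%:C%C by rewrite ltcR divr_gt0.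
have [x Fx] := Fc _ e2; exists (ball x (e / 2)%:C%C) => // u v.
rewrite -ball_normE /= => xu xv; rewrite -knorm_lt//.
rewrite (_ : u - v = (x - v) - (x - u)); last first.
  by rewrite opprB [RHS]addrC addrA subrK.
apply: (le_lt_trans (ler_normB _ _)).
by rewrite [e in ltRHS]splitr rmorphD ltrD.
Qed.

Section PointwiseLimit.
Variables (F : set_system K).
Hypotheses (FF : ProperFilter F) (Fc : cauchy F).

(** [h] stands for the real or the imaginary part. Evaluation at [x] is bounded by [nrm2_point], so
    it carries a Cauchy filter to a Cauchy filter of real numbers. *)
Lemma coordinate_cauchy (h : C -> R) x :
  (forall z z' : C, h (z - z') = h z - h z') ->
  (forall z, h z ^+ 2 <= Re (z * z^*)) -> cvg (h (u x) @[u --> F]).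
Proof.
move=> hB h2; apply: R_complete; apply: cauchy_exP => e e0.
pose c := 1 + Re (k x x).
have c0 : 0 < c.
  rewrite ltr_pwDl//; have := gram_ge0 k [:: (1, x)].
  by rewrite /gram /pairing /combination !big_seq1 /= conjC1 !mul1r.
have d0 : 0 < e / Num.sqrt c by rewrite divr_gt0// sqrtr_gt0.
have [A FA hA] := kernel_space_cauchy_diam FF Fc d0.
have [u Au] := filter_ex FA; exists (h (u x)).
suff : F [set v : K | ball (h (u x)) e (h (v x))] by [].
apply: filterS FA => v Av; rewrite -ball_normE /= -hB.
apply: real_norm_sqr_lt => //; apply: le_lt_trans (h2 _) _.
apply: (le_lt_trans (nrm2_point (u - v) x)); rewrite -/c.
have := hA u v Au Av; rewrite expr_div_n sqr_sqrtr ?ltW// ltr_pdivlMr//.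
by rewrite mulrC.
Qed.

Definition pointwise_limit : X -> C := fun x =>
  (lim (Re (u x) @[u --> F]) +i* lim (complex.Im (u x) @[u --> F]))%C.

Lemma pairing_cvg g :
  (fun u : K => Re (pairing u g)) @ F --> Re (pairing pointwise_limit g).
Proof.
elim: g => [|[c x] g IH].
  rewrite /pairing big_nil (_ : (fun _ => _) = fun=> 0); first exact: cvg_cst.
  by apply/funext => u; rewrite big_nil.
have reE (z : C) : Re (c^* * z) = Re c * Re z + complex.Im c * complex.Im z.
  by case: c z => ? ? [? ?] /=; ring.
pose lr := lim (Re (u x) @[u --> F]);
  pose li := lim (complex.Im (u x) @[u --> F]).
have limE : Re (pairing pointwise_limit ((c, x) :: g)) =
    Re c * lr + complex.Im c * li + Re (pairing pointwise_limit g).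
  by rewrite /pairing big_cons cReD reE.
have funE : (fun u : K => Re (pairing u ((c, x) :: g))) = fun u : K =>
    Re c * Re (u x) + complex.Im c * complex.Im (u x) + Re (pairing u g).
  by apply/funext => u; rewrite /pairing big_cons cReD reE.
rewrite limE funE.
have sq (z : C) : Re z ^+ 2 <= Re (z * z^*) /\ complex.Im z ^+ 2 <=
  Re (z * z^*).
  by rewrite cRe_normC2 lerDl lerDr !sqr_ge0.
apply: cvgD; last exact: IH.
apply: cvgD; apply: cvgM; try exact: cvg_cst.
  by apply: coordinate_cauchy => [|z]; [exact: cReB|case: (sq z)].
by apply: coordinate_cauchy => [z z'|z]; [rewrite raddfB|case: (sq z)].
Qed.

(** Lower semicontinuity of the energy: for fixed [g] the form involves finitely many values of the
    function, hence passes to the pointwise limit, while [M] does not depend on [g]. It serves both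
    to place the limit in the space and to prove convergence to it. *)
Lemma dual_form_limit_le u (M : R) :
  F [set v | nrm2 (u - v) <= M] ->
  forall g, dual_form k ((u : X -> C) - pointwise_limit) g <= M.
Proof.
move=> FM g; apply/ler_addgt0Pr => e e0.
have e2 : 0 < e / 2 by rewrite divr_gt0.
have /cvgrPdist_lt/(_ _ e2) Fe := @pairing_cvg g.
have [v [vM ve]] := filter_ex (filterI FM Fe).
have := energy_ub g (kernel_spaceP (u - v)); rewrite -/(nrm2 (u - v)).
move: vM ve => /= vM; rewrite ltr_norml => /andP[ve _].
rewrite (_ : dual_form k (u - v)%R g = dual_form k ((u : X -> C) - v) g)//.
rewrite /dual_form !pairingD !pairingN !cReD !cReN.
by move: (nrm2 _) vM (Re _) (Re _) (Re _) ve => *; lra.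
Qed.

Lemma pointwise_limit_bounded : kernel_bounded k pointwise_limit.
Proof.
have [A FA hA] := kernel_space_cauchy_diam FF Fc ltr01.
have [u Au] := filter_ex FA.
rewrite (_ : pointwise_limit = (u : X -> C) + (-1) *: ((u : X ->
  C) - pointwise_limit)).
  apply: kernel_boundedD; first exact: kernel_spaceP.
  apply: kernel_boundedZ; exists 1; apply: dual_form_limit_le.
  by apply: filterS FA => v Av /=; rewrite -[1](expr1n _ 2) ltW// hA.
by rewrite scaleN1r opprB addrC subrK.
Qed.

Lemma kernel_space_cvg : cvg F.
Proof.
have mem : pointwise_limit \in kernel_space_pred k.
  exact/asboolP/pointwise_limit_bounded.
apply/cvg_ex; exists (KernelSpace mem); apply/cvgrPdist_lt => e e0.
have r0 : 0 < Re e by move: e0; rewrite ltcE => /andP[].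
have eE : e = (Re e)%:C%C by rewrite RRe_real// gtr0_real.
have r2 : 0 < Re e / 2 by rewrite divr_gt0.
have [A FA hA] := kernel_space_cauchy_diam FF Fc r2.
have lt2 : (Re e / 2) ^+ 2 < Re e ^+ 2 by nra.
apply: (filterS _ FA) => u Au; rewrite eE distrC knorm_lt//.
apply: le_lt_trans lt2.
apply: energy_le; apply: dual_form_limit_le.
by apply: filterS FA => v Av /=; rewrite ltW// hA.
Qed.

End PointwiseLimit.

HB.instance Definition _ := Uniform_isComplete.Build K kernel_space_cvg.

Fact normr_kdot u : `|u| ^+ 2 = kdot u u.
Proof. by rewrite kdotuu normrKE -rmorphXn sqr_sqrtr ?nrm2_ge0. Qed.

HB.instance Definition _ := NormedModule_isHilbert.Build R K normr_kdot.

Lemma dotKE u v : '[u, v] = kdot u v. Proof. by []. Qed.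
End KernelSpaceComplete.

(** * Reproducing property and composition operators *)

Section KernelSpaceTheory.
Variables (R : realType) (X : Type) (k : posdef_kernel R X).
Local Notation C := R[i].
Local Notation K := (kernel_space k : hilbertType R).
Implicit Types (u v : kernel_space k) (g : seq (C * X)) (sigma tau : X -> X).

Definition kernel_comb g : kernel_space k :=
  insubd 0 (combination k g : X -> C).

Lemma kernel_combE g : kernel_comb g = combination k g :> (X -> C).
Proof.
by rewrite /kernel_comb (@insubdK _ _ (kernel_space k))//;
  apply/asboolP/combination_bounded.
Qed.

Lemma kernel_space_ext u v : (forall x, u x = v x) -> u = v.
Proof. by move=> uv; apply/val_inj/funext. Qed.

Lemma nrm2D_comb u g :
  nrm2 (u + kernel_comb g) = nrm2 u + 2 * Re (pairing u g) + gram k g.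
Proof.
rewrite -energy_translate; last exact: kernel_spaceP.
by rewrite -kernel_combE.
Qed.

Lemma kernel_comb_rescale (c : C) g :
  kernel_comb (rescale c g) = c *: kernel_comb g.
Proof.
apply: kernel_space_ext => x.
rewrite kernel_combE combination_rescale -[RHS]/(c * kernel_comb g x).
by rewrite kernel_combE.
Qed.

Lemma rdot_comb u g : rdot u (kernel_comb g) = Re (pairing u g).
Proof.
rewrite /rdot -(scaleN1r (kernel_comb g)) -kernel_comb_rescale !nrm2D_comb.
rewrite gram_rescale pairing_rescale rmorphN1 mulrNN mulr1 mulN1r cReN /=.
by field.
Qed.

Lemma dot_comb u g : '[(u : K), kernel_comb g] = pairing u g.
Proof.
rewrite dotKE /kdot -kernel_comb_rescale !rdot_comb pairing_rescale.
by apply/eqP; rewrite eq_complex /= eqxx /=; case: pairing => a b /=;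
  apply/eqP; ring.
Qed.

(** |u - g|^2 is [nrm2 u] minus the dual form of [u] at [g], so a combination that nearly attains
    the supremum defining [nrm2 u] is close to [u]. *)
Lemma kernel_comb_dense u (e : R) : 0 < e ->
  exists g, `|u - kernel_comb g| < e%:C%C.
Proof.
move=> e0; have es : 0 < e ^+ 2 by rewrite exprn_gt0.
have [_ [g _ <-] hg] := sup_adherent es (energy_has_sup (kernel_spaceP u)).
exists g; rewrite knorm_lt// -(scaleN1r (kernel_comb g)) -kernel_comb_rescale
  nrm2D_comb.
rewrite gram_rescale pairing_rescale rmorphN1 mulrNN mulr1 mulN1r cReN /=.
by move: hg; rewrite /dual_form -/(energy k u) -/(nrm2 u); lra.
Qed.

Lemma kernel_space_dense_eq (L : kernel_space k -> C) (D : R) :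
  (forall u v, L (u - v) = L u - L v) -> (forall u, `|L u| <= D%:C%C * `|u|) ->
  (forall g, L (kernel_comb g) = 0) -> forall u, L u = 0.
Proof.
move=> LB LD Lg u; apply/eqP; rewrite -normr_eq0 eq_le normr_ge0 andbT.
have -> : `|L u| = (Re `|L u|)%:C%C by rewrite RRe_real ?normr_real.
rewrite (lecR _ 0); apply/ler_addgt0Pr => e e0; rewrite add0r.
have c0 : 0 < 1 + `|D| by rewrite ltr_pwDl.
have [g hg] := kernel_comb_dense u (divr_gt0 e0 c0).
rewrite -lecR RRe_real ?normr_real// -[L u]subr0 -(Lg g) -LB.
apply: le_trans (LD _) _.
apply: (@le_trans _ _ ((1 + `|D|)%:C%C * `|u - kernel_comb g|)).
  by rewrite ler_wpM2r// lecR (le_trans (ler_norm _))// lerDr.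
have -> : e%:C%C = (1 + `|D|)%:C%C * (e / (1 + `|D|))%:C%C :> C.
  by rewrite -rmorphM; congr (_%:C%C); field; rewrite gt_eqF.
by rewrite ler_pM2l ?ltcR// ltW.
Qed.

Definition subst_comb sigma g : seq (C * X) := [seq (p.1, sigma p.2) | p <- g].

(** As <u o sigma, g> = <u, sigma g>, composition with [sigma] is bounded once moving the points of
    combinations by [sigma] is. *)
Definition kernel_compat sigma := exists2 B : R, 0 < B &
  forall g, gram k (subst_comb sigma g) <= B * gram k g.

(* Junk value [0] when [u \o sigma] is not bounded, which [kernel_compat sigma]
   rules out. *)
Definition composition sigma u : kernel_space k :=
  insubd 0 ((u : X -> C) \o sigma).

Lemma pairing_subst sigma u g : pairing (u \o sigma) g =
  pairing u (subst_comb sigma g).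
Proof. by rewrite /pairing big_map. Qed.

(** The bound comes from testing [u] on B^-1 sigma(g): the factor B^-1 balances the growth of the
    Gram term against the linear term. *)
Lemma composition_energy sigma (B : R) u : 0 < B ->
  (forall g, gram k (subst_comb sigma g) <= B * gram k g) ->
  forall g, dual_form k (u \o sigma) g <= B * nrm2 u.
Proof.
move=> B0 hB g; have Bi : 0 < B^-1 by rewrite invr_gt0.
have := energy_ub (rescale (B^-1)%:C%C (subst_comb sigma g)) (kernel_spaceP u).
rewrite -/(nrm2 u) -ler_pdivrMl//; apply: le_trans.
rewrite /dual_form pairing_subst pairing_rescale gram_rescale conjC_R !cReRM /=.
have := hB g; set r := Re _; set q := gram k (_ _ _) => hBg.
have : B^-1 * q <= gram k g by rewrite ler_pdivrMl.
by rewrite -(ler_pM2l Bi) mulrBr mulrCA mulrA; lra.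
Qed.

Lemma compositionE sigma u : kernel_compat sigma ->
  composition sigma u = (u : X -> C) \o sigma :> (X -> C).
Proof.
move=> [B B0 hB]; rewrite /composition (@insubdK _ _ (kernel_space k))//.
by apply/asboolP; exists (B * nrm2 u); exact: composition_energy.
Qed.

Lemma composition_bounded sigma : kernel_compat sigma ->
  bounded_op (composition sigma : K -> K).
Proof.
move=> hs; split=> [a u v|].
  apply: kernel_space_ext => x; rewrite compositionE//=.
  by rewrite -[RHS]/(a * composition sigma u x +
    composition sigma v x) !compositionE.
case: (hs) => B B0 hB; exists ((Num.sqrt B)%:C%C) => u.
rewrite !normrKE -rmorphM lecR -sqrtrM ?(ltW B0)// ler_wsqrtr//.
apply: energy_le => g; rewrite compositionE//.
exact: composition_energy.
Qed.

Lemma composition_comb sigma tau g : kernel_compat sigma ->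
  (forall x y, k (tau x) y = k x (sigma y)) ->
  composition sigma (kernel_comb g) = kernel_comb (subst_comb tau g).
Proof.
move=> hs st; apply: kernel_space_ext => x.
rewrite compositionE//= !kernel_combE /combination big_map.
by apply: eq_bigr => p _ /=; rewrite st.
Qed.

(** Both sides are bounded in [v], so by density it suffices to take a combination [g] for [v];
    there the reproducing property turns both into the pairing of [u] with sigma(g). *)
Lemma composition_adjoint sigma tau :
  kernel_compat sigma -> kernel_compat tau ->
  (forall x y, k (sigma x) y = k x (tau y)) ->
  forall u v, '[(composition sigma u : K), v] = '[(u : K), composition tau v].
Proof.
move=> hs ht st u v; apply/eqP; rewrite -subr_eq0; apply/eqP.
have bs := composition_bounded hs; have bt := composition_bounded ht.
have [Ms Ms0 hMs] := bounded_op_ge0 bs; have [Mt Mt0 hMt] := bounded_op_ge0 bt.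
pose L (w : kernel_space k) : C :=
  '[(composition sigma u : K), w] - '[(u : K), composition tau w].
rewrite -/(L v); apply: (@kernel_space_dense_eq _ (Re ((Ms + Mt)%:C%C * `|u|))).
- move=> a b; rewrite /L dotBr; have -> : composition tau (a - b) =
    composition tau a - composition tau b.
    apply: kernel_space_ext => x; rewrite compositionE//=.
    by rewrite -[RHS]/(composition tau a x - composition tau b x) !compositionE.
  by rewrite dotBr; ring.
- move=> w; rewrite /L; apply: le_trans (ler_normB _ _) _.
  rewrite RRe_real ?ger0_real ?mulr_ge0 ?ler0c ?addr_ge0//.
  rewrite rmorphD mulrDl mulrDl; apply: lerD.
    apply: le_trans (dot_CauchySchwarz _ _) _; exact: ler_wpM2r.
  apply: le_trans (dot_CauchySchwarz _ _) _.
  by rewrite -[leRHS]mulrA mulrCA ler_wpM2l.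
- move=> g; rewrite /L dot_comb (composition_comb (tau := sigma))//.
  by rewrite dot_comb compositionE// pairing_subst subrr.
Qed.

End KernelSpaceTheory.

(** Log-convexity makes the ratios b_(n+1) / b_n nondecreasing. If the first one, [q], exceeded [M],
    then b_n >= q^n b_0 would outgrow c M^n, by Bernoulli's inequality for q / M. *)
Lemma log_convex_growth (R : realType) (b : nat -> R) (c M : R) : 0 < M ->
  (forall n, 0 <= b n) -> (forall n, b n.+1 ^+ 2 <= b n * b n.+2) ->
  (forall n, b n <= c * M ^+ n) -> b 1%N <= M * b 0%N.
Proof.
move=> M0 b0 bc bM; rewrite leNgt; apply/negP => b1.
have b00 : 0 < b 0%N.
  rewrite lt_def b0 andbT; apply: contraTneq b1 => b00.
  have := bc 0%N; rewrite b00 mul0r mulr0 -leNgt => h.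
  by have : b 1%N ^+ 2 == 0 by [rewrite eq_le h sqr_ge0];
    rewrite sqrf_eq0 => /eqP ->.
pose q := b 1%N / b 0%N.
have qM : M < q by rewrite ltr_pdivlMr.
have q0 : 0 < q by exact: lt_trans qM.
have step n : 0 < b n /\ q * b n <= b n.+1.
  elim: n => [|n [bn IH]]; first by rewrite /q divfK ?gt_eqF.
  have bn1 : 0 < b n.+1 by apply: lt_le_trans IH; rewrite mulr_gt0.
  split=> //; rewrite -(ler_pM2l bn); apply: le_trans (bc n).
  by rewrite mulrA expr2 (mulrC (b n)) ler_wpM2r// ltW.
have pow n : q ^+ n * b 0%N <= b n.
  elim: n => [|n IH]; first by rewrite expr0 mul1r.
  apply: le_trans (step n).2; rewrite exprS -mulrA ler_wpM2l//; exact: ltW.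
pose d := q / M - 1; have d0 : 0 < d by rewrite subr_gt0 ltr_pdivlMr// mul1r.
have bern n : 1 + n%:R * d <= (q / M) ^+ n.
  have -> : q / M = 1 + d by rewrite addrC subrK.
  elim: n => [|n IH]; first by rewrite mul0r addr0 expr0.
  rewrite exprS -natr1; apply: le_trans (_ : (1 + d) * (1 + n%:R * d) <= _).
    by rewrite -subr_ge0 [leRHS](_ : _ = n%:R * d ^+ 2);
      [rewrite mulr_ge0// sqr_ge0|ring].
  by rewrite ler_wpM2l// addr_ge0// ltW.
have up n : n%:R * d * b 0%N <= c.
  have Mn : 0 < M ^+ n by rewrite exprn_gt0.
  rewrite -(ler_pM2r Mn); apply: le_trans (bM n); apply: le_trans (pow n).
  have := bern n; rewrite expr_div_n ler_pdivlMr// => h.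
  rewrite mulrAC ler_wpM2r//; apply: le_trans h.
  by rewrite mulrDl mul1r lerDr ltW.
have db : 0 < d * b 0%N by rewrite mulr_gt0.
have := up (Num.truncn (c / (d * b 0%N))).+1.
by rewrite -mulrA -ler_pdivlMr// leNgt truncnS_gt.
Qed.

(** * Boundedness from normality and growth *)

Section KernelGrowth.
Variables (R : realType) (X : Type) (k : posdef_kernel R X).
Variables (sigma tau : X -> X) (M : R).
Hypotheses (M0 : 0 < M) (st_comm : forall x, sigma (tau x) = tau (sigma x)).
Hypothesis st_adj : forall x y, k (sigma x) y = k x (tau y).
Hypothesis growth : forall x y, exists c : R, forall n,
  Re `|k (iter n tau x) (iter n tau y)| <= c * M ^+ n.

Lemma kernel_adjC x y : k (tau x) y = k x (sigma y).
Proof. by rewrite kernel_herm -st_adj -kernel_herm. Qed.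

Lemma gram_substE f g : gram k (subst_comb f g) =
  Re (\sum_(q <- g) \sum_(p <- g) q.1^* * (p.1 * k (f p.2) (f q.2))).
Proof.
rewrite /gram /pairing big_map; congr Re; apply: eq_bigr => q _.
by rewrite /combination big_map big_distrr.
Qed.

(** This is |N g| = |N^* g| for a normal N: [sigma] and [tau] commute and are adjoint to each other
    for [k]. *)
Lemma gram_sigma_tau g : gram k (subst_comb sigma g) =
  gram k (subst_comb tau g).
Proof.
rewrite !gram_substE; congr Re; apply: eq_bigr => q _; apply: eq_bigr => p _.
by rewrite st_adj -st_comm kernel_adjC.
Qed.

Lemma gram_CauchySchwarz g h :
  Re (pairing (combination k g) h) ^+ 2 <= gram k g * gram k h.
Proof.
have := rdot_le (kernel_comb k g) (kernel_comb k h).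
have := rdot_le (- kernel_comb k g) (kernel_comb k h).
rewrite rdotNl nrm2N rdot_comb kernel_combE.
have nE f : nrm2 (kernel_comb k f) = gram k f.
  by rewrite -rdotuu rdot_comb kernel_combE.
rewrite !nE => h1 h2; rewrite -[leLHS]real_normK ?num_real//.
rewrite -(sqr_sqrtr (gram_ge0 k g)) -(sqr_sqrtr (gram_ge0 k h)) -exprMn.
rewrite ler_pXn2r ?nnegrE ?mulr_ge0 ?sqrtr_ge0//.
by rewrite ler_norml h2 andbT; lra.
Qed.

Lemma subst_comb_comp f f' (g : seq (R[i] * X)) :
  subst_comb f (subst_comb f' g) = subst_comb (f \o f') g.
Proof. by rewrite /subst_comb -map_comp. Qed.

(** Put b_n = |tau^n g|^2. Moving one [tau] across the form gives b_(n+1) = <tau^n g, sigma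
    tau^(n+1) g>, and with [gram_sigma_tau] Cauchy-Schwarz becomes b_(n+1)^2 <= b_n b_(n+2). The
    growth constant [c] depends on [g], but only the rate [M] enters the conclusion. *)
Lemma gram_tau_le g : gram k (subst_comb tau g) <= M * gram k g.
Proof.
pose b n := gram k (subst_comb (iter n tau) g).
have id0 : subst_comb id g = g.
  by rewrite /subst_comb -[RHS]map_id; apply: eq_map => -[].
have b0E : b 0%N = gram k g by rewrite /b id0.
have bS n : b n.+1 = gram k (subst_comb tau (subst_comb (iter n tau) g)).
  by rewrite subst_comb_comp.
have [c bc] : exists c, forall n, b n <= c * M ^+ n.
  have [cc hcc] : exists cc : X -> X -> R, forall x y n,
      Re `|k (iter n tau x) (iter n tau y)| <= cc x y * M ^+ n.
    have [f hf] := choice (fun xy : X * X => growth xy.1 xy.2).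
    by exists (fun x y => f (x, y)) => x y; exact: (hf (x, y)).
  exists (\sum_(q <- g) \sum_(p <- g) Re `|q.1^* * p.1| * cc p.2 q.2) => n.
  rewrite /b gram_substE cRe_sum mulr_suml; apply: ler_sum => q _.
  rewrite cRe_sum mulr_suml; apply: ler_sum => p _.
  have ReM z w : Re `|z * w| = Re `|z| * Re `|w| :> R.
    by rewrite normrM -[in LHS](RRe_real (normr_real z)) cReRM.
  apply: (@le_trans _ _ (Re `|q.1^* * p.1 * k (iter n tau p.2) (iter n tau
    q.2)|)).
    rewrite mulrA -lecR RRe_real ?normr_real//.
    by apply: le_trans (normc_ge_Re _); rewrite lecR ler_norm.
  rewrite ReM -mulrA ler_wpM2l//.
  by have := normr_ge0 (q.1^* * p.1); rewrite lecE => /andP[].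
rewrite -[tau]/(iter 1 tau) -b0E; apply: (@log_convex_growth _ b c) => //.
  by move=> n; exact: gram_ge0.
move=> n; rewrite [b n.+2]bS [subst_comb _ g]/= -gram_sigma_tau.
have -> : b n.+1 = Re (pairing (combination k (subst_comb (iter n tau) g))
    (subst_comb sigma (subst_comb (iter n.+1 tau) g))).
  rewrite /b gram_substE /pairing !big_map; congr Re.
  apply: eq_bigr => q _; rewrite /combination big_map big_distrr.
  by apply: eq_bigr => p _ /=; rewrite kernel_adjC.
exact: gram_CauchySchwarz.
Qed.

Lemma kernel_compat_tau : kernel_compat k tau.
Proof. by exists M => //; exact: gram_tau_le. Qed.

Lemma kernel_compat_sigma : kernel_compat k sigma.
Proof. by exists M => // g; rewrite gram_sigma_tau gram_tau_le. Qed.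

End KernelGrowth.

(** * Fuglede's theorem *)

(** X^n - 1 is separable in characteristic 0, so it has n distinct roots, and a group of n roots of
    unity contains a primitive one. *)
Lemma numClosed_prim_root (C : numClosedFieldType) (n : nat) : (0 < n)%N ->
  exists z : C, n.-primitive_root z.
Proof.
move=> n0; have [s] := closed_field_poly_normal ('X^n - 1 : {poly C}).
rewrite lead_coefXnsubC// scale1r => sE.
have : has n.-primitive_root s.
  apply: has_prim_root => //.
  - by apply/allP => z zs;
    rewrite -[_.-unity_root _]/(root _ _) sE root_prod_XsubC.
  - rewrite -separable_prod_XsubC -sE separable_Xn_sub_1// pnatr_eq0.
    by rewrite -lt0n.
  - by rewrite -ltnS -(size_prod_XsubC s id) -sE size_XnsubC.
by case/hasP => z _ zp; exists z.
Qed.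

(* Cauchy's estimate, averaging over the [n]-th roots of unity. *)
Lemma coef1_estimate (R : realType) (n : nat) (a : nat -> R[i]) (r G : R) :
  0 <= r -> (1 < n)%N ->
  (forall z : R[i], `|z| = r%:C%C ->
    `|\sum_(0 <= j < n) a j * z ^+ j| <= G%:C%C) ->
  `|a 1%N| * r%:C%C <= G%:C%C.
Proof.
move=> r0 n1 pG; have n0 : (0 < n)%N by exact: ltnW.
have [w wn] := numClosed_prim_root R[i] n0.
have nw : `|w| = 1.
  apply/eqP; rewrite -(@pexpr_eq1 _ _ n)// -normrX (prim_expr_order wn)
    normr1//.
(* The weight is w^(-i). Summed over i, w^(i (n - 1 + j)) vanishes unless n divides n - 1 + j, which
   for 0 <= j < n means j = 1. *)
pose S := \sum_(0 <= i < n) w ^+ (i * n.-1) * \sum_(0 <=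
  j < n) a j * (r%:C%C * w ^+ i) ^+ j.
have -> : `|a 1%N| * r%:C%C = `|S| / n%:R.
  have -> : S = n%:R * (a 1%N * r%:C%C).
    rewrite /S (eq_bigr (fun i => \sum_(0 <=
      j < n) a j * r%:C%C ^+ j * (w ^+ (n.-1 + j)) ^+ i)).
      rewrite exchange_big_nat /= (bigD1_seq 1%N) ?mem_index_iota ?iota_uniq//=.
      rewrite [X in _ + X]big1_seq.
        rewrite addr0 addn1 prednK// (prim_expr_order wn).
        rewrite (eq_bigr (fun=> a 1%N * r%:C%C)); last by move=> i _;
          rewrite expr1n mulr1 expr1.
        by rewrite big_const_nat subn0 iter_addr_0 mulr_natl.
      move=> j /andP[j1]; rewrite mem_index_iota => /andP[_ jn].
      rewrite -big_distrr /= [X in _ * X](_ : _ = 0) ?mulr0//.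
      set z := w ^+ _; have zn : z ^+ n = 1.
        by rewrite /z -exprM mulnC exprM (prim_expr_order wn) expr1n.
      have z1 : z - 1 != 0.
        rewrite subr_eq0 /z -(prim_order_dvd wn); apply: contra j1.
        move=> /dvdnP[[|[|q]] qE]; apply/eqP; [lia|lia|exfalso].
        have : (q.+2 * n = n + n + q * n)%N by rewrite !mulSn addnA.
        by lia.
      by apply: (mulfI z1); rewrite mulr0 big_mkord -subrX1 zn subrr.
    move=> i _; rewrite big_distrr; apply: eq_bigr => j _ /=.
    by rewrite exprMn -!exprM mulrCA [_ * (_ * w ^+ _)]mulrCA -exprD -mulnDr
      mulrA mulnC.
  by rewrite !normrM normr_nat [RHS]mulrC mulKf ?pnatr_eq0 -?lt0n//
    (@ger0_norm _ r%:C%C) ?ler0c.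
rewrite ler_pdivrMr ?ltr0n//; apply: le_trans (ler_norm_sum _ _ _) _.
rewrite mulr_natr -[n in leRHS]subn0 -sumr_const_nat; apply: ler_sum => i _.
rewrite normrM normrX nw expr1n mul1r pG// normrM normrX nw expr1n mulr1.
by rewrite ger0_norm ?ler0c.
Qed.

(* Rosenblum's argument: as [A] commutes with [B], [exp(z ad_A') B] equals
   [exp(S) B exp(- S)] with [S = z A' - z^* A] skew-adjoint, so it is bounded in
   [z] and hence constant.  Replacing exponentials by Euler steps makes it a
   polynomial in [z], whose coefficient of degree 1 is [ad_A' B]. *)
Section Fuglede.
Variables (R : realType) (H : hilbertType R) (A B : H -> H).
Hypotheses (bA : bounded_op A) (bB : bounded_op B).
Hypotheses (AB : commute_op A B) (nA : normal_op A).
Local Notation A' := (adjoint A).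
Implicit Types (x y : H) (z : R[i]) (e r : R) (k : nat).

Let lA : linear A. Proof. by case: bA. Qed.
Let lA' : linear A'. Proof. by case: (adjoint_bounded bA). Qed.

Definition ad_iter j : H -> H := iter j (commutator_op A') B.

Lemma ad_iter_linear j : linear (ad_iter j).
Proof.
elim: j => [|j IH] /=; first by case: bB.
move=> c x y; rewrite /commutator_op -/(ad_iter j) IH lA' lA' IH.
by rewrite scalerBr opprD addrACA.
Qed.

Lemma ad_iter_comm j x : A (ad_iter j x) = ad_iter j (A x).
Proof.
elim: j x => [|j IH] x; first exact: AB.
have nA' y : A (A' y) = A' (A y) by exact: esym (nA y).
by rewrite /= /commutator_op -/(ad_iter j) linear_opB// nA' !IH nA'.
Qed.

Definition skew_part z x := z *: A' x - z^* *: A x.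

Lemma skew_part_linear z : linear (skew_part z).
Proof.
move=> c x y; rewrite /skew_part lA lA' !scalerDr scalerN !scalerA.
by rewrite (mulrC z) (mulrC z^*) opprD addrACA.
Qed.

Lemma skew_partP z x : Re '[x, skew_part z x] = 0.
Proof.
rewrite /skew_part dotBr !dotZr conjCK -adjointP// (dotC x (A x)) cReB.
by rewrite -[X in X - _]cRe_conj conjCM conjCK subrr.
Qed.

(** [A] commutes with every [ad_iter j], so its term drops out and ad_S acts as z ad_A'. This is why
    the Euler iterates are polynomials in [z], although [skew_part z] also contains the conjugate of
    [z]. *)
Lemma skew_part_comm z j x :
  skew_part z (ad_iter j x) - ad_iter j (skew_part z x) = z *: ad_iter j.+1 x.
Proof.
have lD := ad_iter_linear j.
rewrite /skew_part (linear_opB lD) !(linear_opZ lD) ad_iter_comm /=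
  /commutator_op.
by rewrite scalerBr opprB addrA subrK.
Qed.

(* [euler e z k] is the [k]-th Euler step, with step size [e], for the flow
   [exp(t ad_S) B] of the skew-adjoint operator [S = skew_part z], and
   [conj_euler] its variant [(1 + e S)^k B (1 - e S)^k]. *)
Definition euler e z k : H -> H :=
  iter k (fun C x => C x + e%:C%C *: commutator_op (skew_part z) C x) B.

Definition conj_euler e z k : H -> H :=
  iter k (fun C x => C (x - e%:C%C *: skew_part z x) +
    e%:C%C *: skew_part z (C (x - e%:C%C *: skew_part z x))) B.

Lemma euler_expand e z k x :
  euler e z k x = \sum_(0 <=
    j < k.+1) ('C(k, j)%:R * (e%:C%C * z) ^+ j) *: ad_iter j x.
Proof.
set t := e%:C%C * z.
elim: k x => [|k IH] x; first by rewrite big_nat1 bin0 expr0 mulr1 scale1r.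
have -> : euler e z k.+1 x = euler e z k x +
   e%:C%C *: (skew_part z (euler e z k x) - euler e z k (skew_part z x)) by [].
rewrite !IH linear_op_sum; last exact: skew_part_linear.
have -> : e%:C%C *: (\sum_(0 <= j < k.+1)
      skew_part z (('C(k, j)%:R * t ^+ j) *: ad_iter j x) -
    \sum_(0 <= j < k.+1) ('C(k, j)%:R * t ^+ j) *: ad_iter j (skew_part z x)) =
    \sum_(0 <= j < k.+1) ('C(k, j)%:R * t ^+ j.+1) *: ad_iter j.+1 x.
  rewrite -sumrB scaler_sumr; apply: eq_bigr => j _.
  rewrite linear_opZ; last exact: skew_part_linear.
  rewrite -scalerBr skew_part_comm !scalerA; congr (_ *: _).
  by rewrite exprS /t; ring.
rewrite [RHS]big_nat_recl// bin0 expr0 mulr1 scale1r.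
rewrite [in RHS](eq_bigr (fun j => ('C(k, j)%:R * t ^+ j.+1) *: ad_iter j.+1 x +
    ('C(k, j.+1)%:R * t ^+ j.+1) *: ad_iter j.+1 x)); last first.
  by move=> j _; rewrite -scalerDl -mulrDl -natrD binS addnC.
rewrite big_split /= addrCA [LHS]addrC; congr (_ + _).
rewrite [in LHS]big_nat_recl// bin0 expr0 mulr1 scale1r; congr (_ + _).
by rewrite [in RHS]big_nat_recr//= bin_small// mul0r scale0r addr0.
Qed.

Lemma conj_euler_linear e z k : linear (conj_euler e z k).
Proof.
have lS := skew_part_linear z.
elim: k => [|k IH]; first by case: bB.
have l1 : linear (fun x => x - e%:C%C *: skew_part z x).
  move=> c x y; rewrite lS; move: (skew_part z x) (skew_part z y) => p q.
  by rewrite scalerDr opprD addrACA scalerBr !scalerA (mulrC c).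
move=> c x y; rewrite /= -/(conj_euler e z k) l1 IH lS.
move: (conj_euler e z k _) (conj_euler e z k _) => p q.
move: (skew_part z p) (skew_part z q) => p' q'.
by rewrite scalerDr addrACA [in RHS]scalerDr !scalerA (mulrC c).
Qed.

Section Bounds.
Variables (e s b : R) (z : R[i]).
Hypotheses (e0 : 0 <= e) (s0 : 0 <= s) (b0 : 0 <= b).
Hypothesis Sb : forall x, rnorm (skew_part z x) <= s * rnorm x.
Hypothesis Bb : forall x, rnorm (B x) <= b * rnorm x.
Local Notation u := (1 + e ^+ 2 * s ^+ 2).
Local Notation S := (skew_part z).

Let u0 : 0 <= u. Proof. by rewrite addr_ge0 ?mulr_ge0 ?sqr_ge0. Qed.

(** Skewness kills the cross term, so the step expands the norm only to second order in [e]; [c] is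
    [e] or [- e]. With step 1/n, the n-th power of [u] then stays bounded. *)
Lemma skew_step_bound (c : R) x : c ^+ 2 = e ^+ 2 ->
  rnorm (x + c%:C%C *: S x) ^+ 2 <= u * rnorm x ^+ 2.
Proof.
move=> ce; rewrite rnormD_sqr dotZr conjC_R cReRM skew_partP mulr0 mulr0 addr0.
rewrite mulrDl mul1r lerD2l rnormZ exprMn -mulrA.
have -> : Re `|c%:C%C : R[i]| ^+ 2 = e ^+ 2.
  by rewrite normc_def /= expr0n addr0 sqr_sqrtr ?sqr_ge0// sqr_sqrtr ?sqr_ge0.
by rewrite ler_wpM2l ?sqr_ge0// -exprMn ler_pXn2r ?nnegrE ?mulr_ge0 ?rnorm_ge0.
Qed.

Lemma conj_euler_bound k x : rnorm (conj_euler e z k x) <= u ^+ k * b * rnorm x.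
Proof.
elim: k x => [|k IH] x; first by rewrite expr0 mul1r; exact: Bb.
rewrite /= -/(conj_euler e z k).
set y := x - _; set w := conj_euler e z k y.
have hy : rnorm y ^+ 2 <= u * rnorm x ^+ 2.
  by rewrite /y -scaleNr -rmorphN; apply: skew_step_bound; rewrite sqrrN.
rewrite -(ler_pXn2r (n := 2)) ?nnegrE ?mulr_ge0 ?exprn_ge0 ?rnorm_ge0//.
apply: le_trans (skew_step_bound w (erefl (e ^+ 2))) _.
have hw : rnorm w ^+ 2 <= (u ^+ k * b * rnorm y) ^+ 2.
  by rewrite ler_pXn2r ?nnegrE ?IH ?mulr_ge0 ?exprn_ge0 ?rnorm_ge0.
apply: le_trans (ler_wpM2l u0 hw) _; rewrite exprMn mulrA.
apply: (@le_trans _ _ (u * (u ^+ k * b) ^+ 2 * (u * rnorm x ^+ 2))).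
  by rewrite ler_wpM2l// mulr_ge0 ?sqr_ge0.
rewrite (exprS u k); move: (u ^+ k) => q.
by rewrite le_eqVlt; apply/orP; left; apply/eqP; ring.
Qed.

(** Each step adds a defect of size at most e^2 s^2 b u^k, and the error already present is
    amplified by at most 1 + 2 e s, a bound for the norm of 1 + e ad_S. *)
Lemma euler_diff_bound k x : rnorm (conj_euler e z k x - euler e z k x) <=
  k%:R * (e ^+ 2 * s ^+ 2 * b) * u ^+ k * (1 + 2 * e * s) ^+ k * rnorm x.
Proof.
elim: k x => [|k IH] x; first by rewrite subrr !mul0r /rnorm normr0.
have lS := skew_part_linear z; have lX := conj_euler_linear e z k.
pose D x := conj_euler e z k x - euler e z k x.
(* (1 + e S) C (1 - e S) = C + e [S, C] - e^2 S C S: only the last term is foreign to an Euler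
   step. *)
have -> : conj_euler e z k.+1 x - euler e z k.+1 x =
    (D x + e%:C%C *: (S (D x) - D (S x))) - (e ^+ 2)%:C%C *: S (conj_euler e z
      k (S x)).
  rewrite /D [conj_euler e z k.+1 x]/= -/(conj_euler e z k).
  rewrite [euler e z k.+1 x]/= -/(euler e z k) /commutator_op.
  move: (S x) => Sx.
  rewrite !(linear_opB lX) !(linear_opZ lX) !(linear_opB lS) !(linear_opZ lS).
  rewrite rmorphXn expr2 -scalerA; apply: dot_extr => w.
  by rewrite !(dotDr, dotNr, dotZr); ring.
set Xk := rnorm (S (conj_euler e z k (S x))).
pose q := k%:R * (e ^+ 2 * s ^+ 2 * b) * u ^+ k * (1 + 2 * e * s) ^+ k.
have hD y : rnorm (D y) <= q * rnorm y by exact: IH.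
have es0 : 0 <= e * s by rewrite mulr_ge0.
have q0 : 0 <= q.
  by rewrite /q !mulr_ge0 ?exprn_ge0// addr_ge0// -mulrA mulr_ge0.
have h1 : rnorm (S (D x)) <= s * (q * rnorm x).
  by apply: le_trans (Sb _) _; rewrite ler_wpM2l.
have h2 : rnorm (D (S x)) <= q * (s * rnorm x).
  by apply: le_trans (hD _) _; rewrite ler_wpM2l.
have h3 : Xk <= s * (u ^+ k * b * (s * rnorm x)).
  apply: le_trans (Sb _) _; rewrite ler_wpM2l//.
  by apply: le_trans (conj_euler_bound _ _) _;
    rewrite ler_wpM2l// mulr_ge0 ?exprn_ge0.
apply: le_trans (rnormB _ _) _; rewrite (rnormZR _ (sqr_ge0 e)) -/Xk.
apply: (@le_trans _ _ ((q * (1 + 2 * e * s) +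
  e ^+ 2 * s ^+ 2 * b * u ^+ k) * rnorm x)).
  have h4 : rnorm (D x + e%:C%C *: (S (D x) - D (S x))) <=
      q * rnorm x + e * (s * (q * rnorm x) + q * (s * rnorm x)).
    apply: le_trans (rnormD _ _) _; rewrite lerD// rnormZR// ler_wpM2l//.
    by apply: le_trans (rnormB _ _) _; exact: lerD.
  apply: le_trans (lerD h4 (ler_wpM2l (sqr_ge0 e) h3)) _.
  by rewrite le_eqVlt; apply/orP; left; apply/eqP; ring.
rewrite ler_wpM2r ?rnorm_ge0//.
have u1 : 1 <= u by rewrite lerDl mulr_ge0 ?sqr_ge0.
have v1 : 1 <= 1 + 2 * e * s by rewrite lerDl -mulrA mulr_ge0.
have Uv : 1 <= u * (1 + 2 * e * s) ^+ k.+1 by rewrite mulr_ege1// exprn_ege1.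
rewrite -subr_ge0 [leRHS](_ : _ = k%:R * (e ^+ 2 * s ^+ 2 * b) * u ^+ k *
  (1 + 2 * e * s) ^+ k.+1 * (u - 1) +
  (e ^+ 2 * s ^+ 2 * b) * u ^+ k * (u * (1 + 2 * e * s) ^+ k.+1 - 1));
    last first.
  by rewrite /q -natr1 !exprS; ring.
have v0 : 0 <= 1 + 2 * e * s by apply: le_trans v1.
by rewrite addr_ge0// !mulr_ge0 ?sqr_ge0 ?exprn_ge0 ?subr_ge0.
Qed.

End Bounds.
Lemma euler_uniform_bound (r b : R) : 0 <= r -> 0 <= b ->
    (forall x, rnorm (B x) <= b * rnorm x) ->
  exists2 n, (0 < n)%N & forall z, `|z| = r%:C%C ->
    forall x, rnorm (euler n%:R^-1 z n x) <= 2 * expR 1 * b * rnorm x.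
Proof.
move=> r0 b0 Bb; have [a a0 Aa] := bounded_op_rnorm bA.
have [a' a'0 Aa'] := bounded_op_rnorm (adjoint_bounded bA).
pose s := r * (a' + a); have s0 : 0 <= s by rewrite mulr_ge0 ?addr_ge0.
(* The summand s^2 ensures u^n <= exp(s^2 / n) <= exp 1; the summand s^2 exp(2 s) keeps the
   accumulated error below u^n b. Together they give the factor 2 exp 1 in the bound, which is free
   of [r]. *)
pose n := (Num.truncn (s ^+ 2 + s ^+ 2 * expR (2 * s))).+1.
have nr : s ^+ 2 + s ^+ 2 * expR (2 * s) <= n%:R by rewrite ltW// truncnS_gt.
have n0 : 0 < n%:R :> R by rewrite ltr0n.
have ss : 0 <= s ^+ 2 by exact: sqr_ge0.
have sss : 0 <= s ^+ 2 * expR (2 * s) by rewrite mulr_ge0 ?expR_ge0.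
exists n => // z zr x; set e := n%:R^-1.
have e0 : 0 <= e by rewrite invr_ge0 ltW.
have ne : n%:R * e = 1 by rewrite divff ?gt_eqF.
have Sb w : rnorm (skew_part z w) <= s * rnorm w.
  apply: le_trans (rnormB _ _) _;
    rewrite !rnormZ norm_conjC zr /= -mulrDr -mulrA.
  by rewrite ler_wpM2l// mulrDl lerD.
set u := 1 + e ^+ 2 * s ^+ 2.
have u0 : 0 <= u by exact: addr_ge0 ler01 (mulr_ge0 (sqr_ge0 _) (sqr_ge0 _)).
have un : u ^+ n <= expR 1.
  apply: (@le_trans _ _ (expR (e ^+ 2 * s ^+ 2) ^+ n)).
    by rewrite lerXn2r ?nnegrE ?expR_ge0 ?expR_ge1Dx.
  rewrite -expRM_natl ler_expR (_ : n%:R * _ = e * s ^+ 2); last first.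
    by rewrite -[RHS]mul1r -[in RHS]ne; ring.
  by rewrite -(ler_pM2l n0) mulrA ne mul1r mulr1; lra.
have vn : (1 + 2 * e * s) ^+ n <= expR (2 * s).
  have -> : 2 * s = n%:R * (2 * e * s).
    by rewrite mulrA (mulrCA _ 2) ne mulr1.
  rewrite expRM_natl lerXn2r ?nnegrE ?expR_ge0 ?expR_ge1Dx//.
  by do 2?[apply: addr_ge0 => //]; do 2?[apply: mulr_ge0 => //].
have nv : n%:R * (e ^+ 2 * s ^+ 2) * (1 + 2 * e * s) ^+ n <= 1.
  rewrite (_ : _ * (e ^+ 2 * _) = e * s ^+ 2); last first.
    by rewrite -[RHS]mul1r -[in RHS]ne; ring.
  apply: (@le_trans _ _ (e * s ^+ 2 * expR (2 * s))).
    by rewrite ler_wpM2l// mulr_ge0.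
  rewrite -(ler_pM2l n0) mulr1 (_ : n%:R * _ = s ^+ 2 * expR (2 * s));
    first by lra.
  transitivity (n%:R * e * (s ^+ 2 * expR (2 * s))); first by ring.
  by rewrite ne mul1r.
have -> : euler e z n x =
  conj_euler e z n x - (conj_euler e z n x - euler e z n x).
  by rewrite opprB addrC subrK.
apply: le_trans (rnormB _ _) _.
apply: le_trans (lerD (conj_euler_bound e0 s0 b0 Sb Bb n x)
  (euler_diff_bound e0 s0 b0 Sb Bb n x)) _.
rewrite -mulrDl ler_wpM2r ?rnorm_ge0//.
have un0 : 0 <= u ^+ n by rewrite exprn_ge0.
apply: (@le_trans _ _ (u ^+ n * b + 1 * (u ^+ n * b))).
  rewrite lerD2l -/u.
  rewrite (_ : _ * u ^+ n * _ =
    n%:R * (e ^+ 2 * s ^+ 2) * (1 + 2 * e * s) ^+ n * (u ^+ n * b)).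
    by rewrite ler_wpM2r// mulr_ge0.
  by ring.
have : u ^+ n * b <= expR 1 * b by rewrite ler_wpM2r.
by lra.
Qed.

(** For each radius [r] the polynomial changes, through [n], but neither its bound [G] nor its
    coefficient of degree 1 does: 'C(n, 1) cancels the step 1/n, leaving [c]. Hence |c| r <= G for
    all [r], and [c] is 0. *)
Lemma Fuglede x : A' (B x) = B (A' x).
Proof.
apply/eqP; rewrite -subr_eq0 -[_ - _]/(ad_iter 1 x); apply/eqP.
apply: (@dot_extl _ _ _ 0) => y; rewrite dot0l.
have [b b0 Bb] := bounded_op_rnorm bB.
pose G := 2 * expR 1 * b * rnorm x * rnorm y.
pose c := '[ad_iter 1 x, y].
have main (r : R) : 0 <= r -> `|c| * r%:C%C <= G%:C%C.
  move=> r0; have [n n0 hn] := euler_uniform_bound r0 b0 Bb.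
  pose e : R := n%:R^-1.
  pose a j := 'C(n, j)%:R * e%:C%C ^+ j * '[ad_iter j x, y].
  have -> : c = a 1%N.
    rewrite /a bin1 expr1 /e fmorphV rmorph_nat divff ?mul1r//.
    by rewrite pnatr_eq0 -lt0n.
  apply: (@coef1_estimate _ n.+1) => // z zr.
  have -> : \sum_(0 <= j < n.+1) a j * z ^+ j = '[euler e z n x, y].
    rewrite euler_expand dot_suml; apply: eq_bigr => j _.
    by rewrite dotZl /a exprMn; ring.
  apply: le_trans (rnorm_dot _ _) _; rewrite lecR.
  by rewrite ler_wpM2r ?rnorm_ge0// hn.
have cE : `|c| = (Re `|c|)%:C%C by rewrite RRe_real ?normr_real.
have cr0 : 0 <= Re `|c| by rewrite -ler0c -cE.
apply/eqP; rewrite -/c -normr_eq0 cE.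
suff -> : Re `|c| = 0 by [].
apply/eqP; rewrite eq_le cr0 andbT leNgt; apply/negP => cp.
have G0 : 0 <= G by rewrite /G !mulr_ge0 ?rnorm_ge0 ?expR_ge0.
have := main ((1 + G) / Re `|c|);
  rewrite cE -rmorphM lecR mulrCA divff ?gt_eqF//.
by move=> /(_ (divr_ge0 (addr_ge0 ler01 G0) cr0)); lra.
Qed.

End Fuglede.

(** * Tuples of operators *)

Section Tuples.
Variable R : realType.
Implicit Types H K : hilbertType R.

Lemma hyponormal_formE H n (S : n.-tuple (H -> H)) (x : 'I_n -> H) :
  (forall i, bounded_op (tnth S i)) ->
  \sum_i '[\sum_j commutator_op (adjoint (tnth S j)) (tnth S i) (x j), x i] =
  \sum_i \sum_j '[tnth S i (x j), tnth S j (x i)] -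
  '[\sum_j adjoint (tnth S j) (x j), \sum_j adjoint (tnth S j) (x j)].
Proof.
move=> bS; rewrite dot_sumr -sumrB; apply: eq_bigr => i _.
rewrite !dot_suml -sumrB; apply: eq_bigr => j _.
by rewrite /commutator_op dotBl (adjointP (bS i)) (adjoint_dot (bS j)).
Qed.

Lemma subnormal_hyponormal H n (S : n.-tuple (H -> H)) :
  (forall i, bounded_op (tnth S i)) -> subnormal S -> hyponormal S.
Proof.
move=> bS [K [V [N [Vlin Viso [bN cN nN] NV]]]] x.
rewrite hyponormal_formE// subr_ge0.
pose w := \sum_i adjoint (tnth N i) (V (x i)).
set u := \sum_j adjoint _ _.
have -> : \sum_i \sum_j '[tnth S i (x j), tnth S j (x i)] = '[w, w].
  rewrite /w dot_sumr; apply: eq_bigr => i _; rewrite dot_suml.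
  apply: eq_bigr => j _; rewrite -Viso -!NV (adjoint_dot (bN j)).
  by rewrite -(Fuglede (bN i) (bN j) (cN i j) (nN i)) -adjointP.
(* This says in effect that [u] is V^* w, so |u| <= |w| follows from expanding |V u - w|^2 >= 0. *)
have uw : '[V u, w] = '[u, u].
  rewrite {2}/u dot_sumr /w dot_sumr; apply: eq_bigr => j _.
  by rewrite -adjointP// NV Viso adjointP.
have := dot_ge0 (V u - w); rewrite dotBl !dotBr uw (dotC w) uw -dotC Viso.
by rewrite subrr sub0r opprB subr_ge0.
Qed.

Lemma commute_op_sym H (S T : H -> H) : commute_op S T -> commute_op T S.
Proof. by move=> ST x; rewrite -ST. Qed.

Lemma commute_op_comp H (S T T' : H -> H) :
  commute_op S T -> commute_op S T' -> commute_op S (T \o T').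
Proof.
move=> ST ST' x /=; have /= -> := ST (T' x).
by congr T; exact: ST'.
Qed.

Lemma commute_op_iter H (S T : H -> H) n : commute_op S T ->
  commute_op S (iter n T).
Proof.
move=> ST; elim: n => [//|n IH] x; have /= -> := ST (iter n T x).
by congr T; exact: IH.
Qed.

Lemma commute_op_monomial H (S T1 T2 : H -> H) a :
  commute_op S T1 -> commute_op S T2 -> commute_op S (monomial T1 T2 a).
Proof. by move=> h1 h2; apply: commute_op_comp; exact: commute_op_iter. Qed.

Lemma bounded_op_comp H (S T : H -> H) :
  bounded_op S -> bounded_op T -> bounded_op (S \o T).
Proof.
move=> bS bT; split=> [c x y /=|]; first by rewrite bT.1 bS.1.
have [M M0 hM] := bounded_op_ge0 bS; have [M' M'0 hM'] := bounded_op_ge0 bT.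
exists (M%:C%C * M'%:C%C) => x /=; apply: le_trans (hM _) _.
by rewrite -mulrA ler_wpM2l ?ler0c.
Qed.

Lemma bounded_op_iter H (T : H -> H) n : bounded_op T -> bounded_op (iter n T).
Proof.
move=> bT; elim: n => [|n IH]; last exact: bounded_op_comp.
by split=> //; exists 1 => x; rewrite mul1r.
Qed.

Lemma bounded_op_monomial H (T1 T2 : H -> H) a :
  bounded_op T1 -> bounded_op T2 -> bounded_op (monomial T1 T2 a).
Proof. by move=> b1 b2; apply: bounded_op_comp; exact: bounded_op_iter. Qed.

Lemma adjoint_iter H (T : H -> H) n : bounded_op T ->
  forall x y, '[iter n T x, y] = '[x, iter n (adjoint T) y].
Proof.
move=> bT; elim: n => [//|n IH] x y.
by rewrite iterS adjointP// IH -iterSr.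
Qed.

Lemma adjoint_monomial H (T1 T2 : H -> H) a : bounded_op T1 -> bounded_op T2 ->
  adjoint (monomial T1 T2 a) =1 monomial (adjoint T2) (adjoint T1) (a.2, a.1).
Proof.
move=> b1 b2; apply: adjoint_unique => x y.
by rewrite /= !adjoint_iter.
Qed.

(** The mixed relations between the adjoint of one factor and the other factor are not part of
    [normal_tuple]; [Fuglede] supplies them. *)
Lemma normal_op_monomial H (N1 N2 : H -> H) a :
  normal_tuple [tuple N1; N2] -> normal_op (monomial N1 N2 a).
Proof.
move=> [bN cN nN].
have b1 : bounded_op N1 := bN ord0; have b2 : bounded_op N2 := bN ord_max.
have n1 : normal_op N1 := nN ord0; have n2 : normal_op N2 := nN ord_max.
have c12 : commute_op N1 N2 := cN ord0 ord_max.
have f12 : commute_op (adjoint N1) N2 by move=> x; exact: Fuglede.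
have f21 : commute_op (adjoint N2) N1.
  by move=> x; apply: Fuglede => //; exact: commute_op_sym.
move=> x /=; rewrite !adjoint_monomial//.
apply: (commute_op_sym (S := monomial N1 N2 a)).
apply: commute_op_monomial; apply: commute_op_sym; exact: commute_op_monomial.
Qed.

Lemma tnth_monomials H (T1 T2 : H -> H) k i :
  tnth (monomials T1 T2 k) i = monomial T1 T2 (tnth (in_tuple (exponents k)) i).
Proof. by rewrite tnth_map. Qed.

Lemma subnormal_monomials H (T1 T2 : H -> H) k :
  subnormal [tuple T1; T2] -> subnormal (monomials T1 T2 k).
Proof.
move=> [K [V [N [Vlin Viso nN NV]]]].
pose N1 := tnth N ord0; pose N2 := tnth N ord_max.
have NE : N = [tuple N1; N2].
  by apply: eq_from_tnth => -[[|[|//]] i2]; congr tnth; apply: val_inj.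
rewrite NE in nN; have [bN cN _] := nN.
have b1 : bounded_op N1 := bN ord0; have b2 : bounded_op N2 := bN ord_max.
have c12 : commute_op N1 N2 := cN ord0 ord_max.
exists K, V, (monomials N1 N2 k); split=> //.
  split=> [i|i j|i]; rewrite !tnth_monomials.
  - exact: bounded_op_monomial.
  - apply: commute_op_monomial; apply: commute_op_sym;
      apply: commute_op_monomial => //; exact: commute_op_sym.
  - exact: normal_op_monomial.
move=> i x; rewrite !tnth_monomials; move: (tnth _ _) => [a b].
have V1 y : N1 (V y) = V (T1 y) := NV ord0 y.
have V2 y : N2 (V y) = V (T2 y) := NV ord_max y.
have e1 n y : iter n N1 (V y) = V (iter n T1 y).
  by elim: n => //= n ->; exact: V1.
have e2 n y : iter n N2 (V y) = V (iter n T2 y).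
  by elim: n => //= n ->; exact: V2.
by rewrite /monomial /= e1 e2.
Qed.

(** [exponents 1] is the list (1,0), (0,1), so the tuple for k = 1 is the pair itself up to its
    index type. *)
Lemma subnormal_pair_of_monomials H (T1 T2 : H -> H) :
  subnormal (monomials T1 T2 1) -> subnormal [tuple T1; T2].
Proof.
move=> [K [V [N [Vlin Viso [bN cN nN] NV]]]].
pose i0 : 'I_(size (exponents 1)) := ord0.
pose i1 : 'I_(size (exponents 1)) := ord_max.
exists K, V, [tuple tnth N i0; tnth N i1]; split=> //.
  have tE j : tnth [tuple tnth N i0; tnth N i1] j =
              tnth N (if j == ord0 then i0 else i1).
    by case: j => -[|[|//]].
  by split=> [i|i j|i]; rewrite !tE.
by move=> [[|[|//]] i2] x; [exact: (NV i0)|exact: (NV i1)].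
Qed.

End Tuples.

(** * The moment kernel *)

Section Positivity.
Variables (R : realType) (H : hilbertType R).

(** [None] indexes the adjoined identity, that is, the monomial of exponent (0,0), which [exponents]
    omits. *)
Definition opt_op n (S : n.-tuple (H -> H)) (o : option 'I_n) : H -> H :=
  if o is Some i then tnth S i else id.

(* Adjoining the identity to the tuple: this is where a Schur complement turns
   hyponormality into the Bram-Halmos positivity condition. *)
Lemma hyponormal_pos n (S : n.-tuple (H -> H)) (g : seq (option 'I_n * H)) :
  (forall i, bounded_op (tnth S i)) -> hyponormal S ->
  0 <= \sum_(p <- g) \sum_(q <- g) '[opt_op S q.1 p.2, opt_op S p.1 q.2].
Proof.
move=> bS hS; pose op := opt_op S;
  pose aop (o : option 'I_n) := if o is Some i then adjoint (tnth S i) else id.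
(* Completing the square: the form is the sum of the [d p q] plus the squared norm of the sum of the
   [aop p.1 p.2]. As [d] vanishes when an index is [None], the first part is the hyponormality
   form. *)
pose d (p q : option 'I_n * H) :=
  '[op q.1 p.2, op p.1 q.2] - '[aop p.1 p.2, aop q.1 q.2].
pose gs j := [seq p <- g | p.1 == Some j].
pose x j := \sum_(p <- gs j) p.2.
have lS i : linear (tnth S i) by case: (bS i).
have lS' i : linear (adjoint (tnth S i)) by case: (adjoint_bounded (bS i)).
(* Indices may repeat in [g]; grouping by index collects the vectors of each [Some j] into the
   single vector [x j] to which hyponormality applies. *)
have collect (F : option 'I_n * H -> R[i]) : (forall u, F (None, u) = 0) ->
    \sum_(p <- g) F p = \sum_j \sum_(p <- gs j) F (Some j, p.2).
  move=> F0; rewrite [RHS](eq_bigr _ (fun j _ => big_filter _ _ _)).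
  rewrite (exchange_big_dep xpredT)//=; apply: eq_bigr => -[[i|] u] _ /=.
    rewrite (eq_bigl (xpred1 i)) ?big_pred1_eq// => j.
    by rewrite (inj_eq (@Some_inj _)) eq_sym.
  by rewrite F0 big_pred0.
have -> : \sum_(p <- g) \sum_(q <- g) '[opt_op S q.1 p.2, opt_op S p.1 q.2] =
    \sum_(p <- g) \sum_(q <- g) d p q +
    '[\sum_(p <- g) aop p.1 p.2, \sum_(p <- g) aop p.1 p.2].
  rewrite dot_suml -big_split; apply: eq_bigr => p _ /=.
  rewrite dot_sumr -big_split; apply: eq_bigr => q _ /=.
  by rewrite /d subrK.
apply: addr_ge0; last exact: dot_ge0.
have d0l u q : d (None, u) q = 0.
  by case: q => -[i|] v; rewrite /d /= ?subrr// (adjointP (bS i)) subrr.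
have d0r p u : d p (None, u) = 0.
  by case: p => -[i|] v; rewrite /d /= ?subrr// (adjoint_dot (bS i)) subrr.
rewrite (collect (fun p => \sum_(q <- g) d p q)); last first.
  by move=> u; rewrite big1// => q _; rewrite d0l.
have := hS x; rewrite hyponormal_formE// dot_sumr -sumrB; congr (_ <= _).
rewrite [RHS](_ : _ = \sum_j \sum_i \sum_(p <- gs j)
    \sum_(q <- gs i) d (Some j, p.2) (Some i, q.2)); last first.
  apply: eq_bigr => j _; rewrite [RHS]exchange_big /=; apply: eq_bigr => p _.
  by rewrite (collect (d (Some j, p.2)))// => u; exact: d0r.
rewrite exchange_big /=; apply: eq_bigr => i _; rewrite dot_suml -sumrB.
apply: eq_bigr => j _; rewrite /x.
rewrite !(linear_op_sum (lS _)) !(linear_op_sum (lS' _)) !dot_suml -sumrB.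
apply: eq_bigr => p _; rewrite !dot_sumr -sumrB.
by apply: eq_bigr => q _.
Qed.

End Positivity.

Lemma mem_exponents k a : (0 < a.1 + a.2 <= k)%N -> a \in exponents k.
Proof.
case: a => a b /= /andP[h0 hk]; apply/allpairsPdep; exists (a + b)%N, b.
by rewrite !mem_iota addnK; split=> //; lia.
Qed.

(** * The normal extension of a pair *)

Section Model.
Variables (R : realType) (H : hilbertType R) (T1 T2 : H -> H).
Hypotheses (b1 : bounded_op T1) (b2 : bounded_op T2) (c12 : commute_op T1 T2).
Hypothesis hyp : forall k : nat, (1 <= k)%N -> k_hyponormal T1 T2 k.
Local Notation mono := (monomial T1 T2).
Local Notation X := (nat * nat * H)%type.

Let bmono a : bounded_op (mono a). Proof. exact: bounded_op_monomial. Qed.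

(** The exponent (0,0) is absent from the list, so its index is the size of the list, [insub]
    returns [None], and the identity is indeed its monomial. *)
Lemma opt_op_monomials k a : (a.1 + a.2 <= k)%N ->
  opt_op (monomials T1 T2 k) (insub (index a (exponents k))) = mono a.
Proof.
move=> ak; case: insubP => [i|]; rewrite index_mem.
  move=> ain iE; rewrite /= tnth_monomials (tnth_nth (0%N, 0%N)) /= iE.
  by rewrite nth_index.
apply: contraNeq => neq; apply: mem_exponents; rewrite ak andbT.
by case: a {ak} neq => -[|a] [|b]//= /eqP[].
Qed.

(* In a subnormal extension [N] this is the inner product of [N^{*b} x] and
   [N^{*a} y], where [p = (b, x)] and [q = (a, y)]. *)
Definition moment_form (p q : X) : R[i] := '[mono q.1 p.2, mono p.1 q.2].

Fact moment_herm p q : moment_form q p = (moment_form p q)^*.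
Proof. exact: dotC. Qed.

Fact moment_pos (g : seq (R[i] * X)) : 0 <=
  \sum_(p <- g) \sum_(q <- g) p.1 * q.1^* * moment_form p.2 q.2.
Proof.
(* The sum dominates the degree of every exponent in [g]; the successor makes k >= 1 even when that
   sum is 0. The scalars of [g] are absorbed into the vectors below. *)
pose k := (\sum_(p <- g) (p.2.1.1 + p.2.1.2)).+1.
have hk p : p \in g -> (p.2.1.1 + p.2.1.2 <= k)%N.
  by move=> pg; rewrite /k (big_rem p)//= -addnS leq_addr.
pose o (a : nat * nat) : option 'I_(size (exponents k)) :=
  insub (index a (exponents k)).
have := @hyponormal_pos _ _ _ (monomials T1 T2 k)
  [seq (o p.2.1, p.1 *: p.2.2) | p <- g].
rewrite big_map => pos; apply: le_trans (pos _ (hyp _)) _ => //.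
  by move=> i; rewrite tnth_monomials; exact: bmono.
rewrite le_eqVlt; apply/orP; left; apply/eqP.
apply: eq_big_seq => p pg; rewrite big_map; apply: eq_big_seq => q qg /=.
rewrite /o (opt_op_monomials (hk p pg)) (opt_op_monomials (hk q qg))
  /moment_form.
rewrite !(linear_opZ (proj1 (bmono _))) dotZl dotZr; ring.
Qed.

Definition moment_kernel := PosdefKernel moment_herm moment_pos.

Local Notation K := (kernel_space moment_kernel : hilbertType R).

Definition shift1 (p : X) : X := ((p.1.1.+1, p.1.2), p.2).
Definition shift2 (p : X) : X := ((p.1.1, p.1.2.+1), p.2).
Definition apply_op (T : H -> H) (p : X) : X := (p.1, T p.2).

Lemma monomial_S1 a b x : mono (a.+1, b) x = mono (a, b) (T1 x).
Proof. by rewrite /monomial /= -iterSr. Qed.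

Lemma monomial_S2 a b x : mono (a, b.+1) x = mono (a, b) (T2 x).
Proof.
have /(_ x) /= c : commute_op T2 (iter a T1).
  by apply: commute_op_iter; exact: commute_op_sym.
by rewrite /monomial /= -iterS iterSr c.
Qed.

Lemma shift1_adj p q : moment_kernel (shift1 p) q =
  moment_kernel p (apply_op T1 q).
Proof. by case: p q => [[a b] x] [[c d] y];
  rewrite /= /moment_form /= monomial_S1. Qed.

Lemma shift2_adj p q : moment_kernel (shift2 p) q =
  moment_kernel p (apply_op T2 q).
Proof. by case: p q => [[a b] x] [[c d] y];
  rewrite /= /moment_form /= monomial_S2. Qed.

Lemma moment_growth (T : H -> H) : bounded_op T ->
  exists2 M : R, 0 < M & forall p q : X, exists c : R, forall n,
    Re `|moment_form (p.1, iter n T p.2) (q.1, iter n T q.2)| <= c * M ^+ n.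
Proof.
(* The rate must be positive, even for T = 0, hence m + 1. *)
move=> /bounded_op_rnorm[m m0 hm]; have m1 : 0 < m + 1 by rewrite ltr_wpDl.
have hiter n x : rnorm (iter n T x) <= (m + 1) ^+ n * rnorm x.
  elim: n => [|n IH] /=; first by rewrite expr0 mul1r.
  apply: le_trans (hm _) _; rewrite exprS -mulrA.
  by apply: ler_pM => //; [exact: rnorm_ge0|rewrite lerDl].
exists ((m + 1) ^+ 2) => [|p q]; first exact: exprn_gt0.
have [Mq Mq0 hq] := bounded_op_rnorm (bmono q.1).
have [Mp Mp0 hp] := bounded_op_rnorm (bmono p.1).
exists (Mq * rnorm p.2 * (Mp * rnorm q.2)) => n.
rewrite -lecR RRe_real ?normr_real//; apply: le_trans (rnorm_dot _ _) _.
rewrite lecR; apply: (@le_trans _ _ (Mq * ((m + 1) ^+ n * rnorm p.2) *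
  (Mp * ((m + 1) ^+ n * rnorm q.2)))); last first.
  by rewrite -exprM mulnC exprM le_eqVlt; apply/orP; left; apply/eqP; ring.
apply: ler_pM; [exact: rnorm_ge0|exact: rnorm_ge0| |].
  by apply: le_trans (hq _) _; rewrite /= ler_wpM2l.
by apply: le_trans (hp _) _; rewrite /= ler_wpM2l.
Qed.

Lemma iter_apply_op T n p : iter n (apply_op T) p = (p.1, iter n T p.2).
Proof. by elim: n => [|n /= ->//]; case: p. Qed.

Lemma shift_compat sigma T : bounded_op T ->
  (forall p, sigma (apply_op T p) = apply_op T (sigma p)) ->
  (forall p q, moment_kernel (sigma p) q = moment_kernel p (apply_op T q)) ->
  kernel_compat moment_kernel sigma /\ kernel_compat moment_kernel (apply_op T).
Proof.
move=> bT comm adj; have [M M0 hM] := moment_growth bT.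
have gr p q : exists c : R, forall n, Re `|moment_kernel (iter n (apply_op T) p)
    (iter n (apply_op T) q)| <= c * M ^+ n.
  by have [c hc] := hM p q; exists c => n; rewrite !iter_apply_op.
split.
  exact: (@kernel_compat_sigma _ _ moment_kernel sigma _ M M0 comm adj gr).
exact: (@kernel_compat_tau _ _ moment_kernel sigma _ M M0 comm adj gr).
Qed.

Definition model1 : K -> K := composition shift1.
Definition model2 : K -> K := composition shift2.
(** The reproducing element at ((0,0), x), which is the function (a, y) |-> <T^a x, y>. In this form
    it is visibly linear in [x], and raising the exponent amounts to replacing x by T_i x. *)
Definition model_embed (x : H) : K :=
  kernel_comb moment_kernel [:: (1, ((0%N, 0%N), x))].

Lemma model_embedE x p : (model_embed x : kernel_space moment_kernel) p =
  '[mono p.1 x, p.2].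
Proof. by rewrite kernel_combE /combination big_seq1 /= mul1r. Qed.

Lemma composition_comm (sigma tau : X -> X) :
  kernel_compat moment_kernel sigma -> kernel_compat moment_kernel tau ->
  (forall p, sigma (tau p) = tau (sigma p)) ->
  commute_op (composition sigma : K -> K) (composition tau).
Proof.
move=> cs ct st u; apply: kernel_space_ext => p /=.
by do 4?[rewrite compositionE//=]; rewrite st.
Qed.

Lemma model_subnormal : subnormal [tuple T1; T2].
Proof.
have [cs1 ca1] := shift_compat (sigma := shift1) b1 (fun=> erefl) shift1_adj.
have [cs2 ca2] := shift_compat (sigma := shift2) b2 (fun=> erefl) shift2_adj.
exists K, model_embed, [tuple model1; model2]; split.
- move=> a x y; apply: kernel_space_ext => p.
  rewrite -[RHS]/(a * (model_embed x : kernel_space moment_kernel) p +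
    (model_embed y : kernel_space moment_kernel) p) !model_embedE.
  by rewrite (proj1 (bmono _)) dotDl dotZl.
- by move=> x y; rewrite dot_comb /pairing big_seq1 /= conjC1 mul1r
  model_embedE.
- have adj1 : adjoint model1 =1 composition (apply_op T1).
    exact/adjoint_unique/(composition_adjoint cs1 ca1 shift1_adj).
  have adj2 : adjoint model2 =1 composition (apply_op T2).
    exact/adjoint_unique/(composition_adjoint cs2 ca2 shift2_adj).
  split.
  + by move=> [[|[|//]] i]; exact: composition_bounded.
  + by move=> [[|[|//]] i] [[|[|//]] j]; exact: composition_comm.
  + move=> [[|[|//]] i] u /=; rewrite ?adj1 ?adj2; exact: composition_comm.
- move=> [[|[|//]] i] x; apply: kernel_space_ext => -[[a b] y].
    by rewrite /= compositionE//= !model_embedE /= monomial_S1.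
  by rewrite /= compositionE//= !model_embedE /= monomial_S2.
Qed.

End Model.

Theorem theorem2p3 (R : realType) (H : hilbertType R) (T1 T2 : H -> H)
    (T1_bounded : bounded_op T1) (T2_bounded : bounded_op T2)
    (T1T2_commute : commute_op T1 T2) :
  (subnormal [tuple T1; T2] <->
   forall k : nat, (1 <= k)%N -> subnormal (monomials T1 T2 k)) /\
  (subnormal [tuple T1; T2] <->
   forall k : nat, (1 <= k)%N -> k_hyponormal T1 T2 k).
Proof.
split; split.
- by move=> sT k _; exact: subnormal_monomials.
- by move=> sT; apply: subnormal_pair_of_monomials; exact: sT.
- move=> sT k _; apply: subnormal_hyponormal; last exact: subnormal_monomials.
  by move=> i; rewrite tnth_monomials; exact: bounded_op_monomial.
- exact: model_subnormal.
Qed.
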